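(* Let $\mathscr B$ be a (separable) doubling ball-basis in a measure space $(X,\mu)$, $r\ge1$, and $\mathbb U$ a Banach space. Let $\phi=\{\phi_B:B\in\mathscr B\}$ be an $\omega$-regular family of functions on $X$ and $\mathscr G=\bigcup_{x\in X}\mathscr G(x)$, where each $\mathscr G(x)$ is a family of balls complete at $x$. If the modulus of continuity $\omega$ satisfies $$\|\omega\|=1+\int_0^1\frac{\omega(t)\log(1/t)}{t}\,dt<\infty,$$ then for any function $f\in L^r(X,\mathbb U)$ and any ball $B\in\mathscr B$ $$\mathrm{OSC}_{B,\alpha}\big(\mathcal M^{\phi,\mathscr G}(f)\big)\lesssim\|\omega\|\,(1-\alpha)^{-1/r}\,\langle f\rangle^*_{\#,B}$$ for any $0<\alpha<1$.
   Context: Ball-basis. Let $(X,\mathfrak M,\mu)$ be a measure space. A family $\mathscr B$ of measurable sets (balls) is a ball-basis if: (B1) $0<\mu(B)<\infty$ for $B\in\mathscr B$; (B2) any two points lie in a common ball; (B3) for any $E\in\mathfrak M$, $\varepsilon>0$ there is a finite or infinite sequence of balls $B_k$ with $\mu(E\triangle\bigcup_kB_k)<\varepsilon$; (B4) for any $B\in\mathscr B$ there is a ball $[B]\in\mathscr B$ with $B^*:=\bigcup_{A\in\mathscr B:\ \mu(A)\le2\mu(B),\ A\cap B\ne\varnothing}A\subset[B]$ and $\mu([B])\le\mathcal K\mu(B)$, $\mathcal K$ independent of $B$. All ball-bases are assumed separable (arbitrary unions of balls are measurable). $\mathscr B$ is doubling if there is $\eta>1$ such that for every ball $B$ with $B^*\ne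 X$ there is a ball $B'\supsetneq B$ with $\mu(B')\le\eta\mu(B)$. Notation. $f_B=\frac1{\mu(B)}\int_Bf$, $\langle f\rangle_{\#,B}=\big(\frac1{\mu(B)}\int_B\|f-f_B\|_{\mathbb U}^r\big)^{1/r}$, $\langle f\rangle^*_{\#,B}=\sup_{A\in\mathscr B,A\supset B}\langle f\rangle_{\#,A}$. $\mathrm{OSC}_E(g)=\operatorname{esssup}_{x,x'\in E}|g(x)-g(x')|$; $\mathrm{OSC}_{B,\alpha}(g)=\inf_{E\subset B:\,\mu(E)>\alpha\mu(B)}\mathrm{OSC}_E(g)$. Volume distance: $d(x,B)=\inf\{\mu(A):A\in\mathscr B,\ A\supset B\cup\{x\}\}$. A modulus of continuity is a monotone increasing and subadditive function $\omega:(0,1]\to(0,1]$. A family of non-negative real valued functions $\phi=\{\phi_B:B\in\mathscr B\}\subset L^1(X)$ is $\omega$-regular if (1) $\|\phi_B\|_{L^1(X)}=1$; (2) there is an increasing function $\gamma:[1,\infty)\to[1,\infty)$ with $\phi_B(x)\le\gamma(\mu(A)/\mu(B))\phi_A(x)$ for every two balls $B\subset A$; (3) there are positive constants $c_1,c_2$ such that for any ball $B$, $c_1\frac{\mathbf 1_B(x)}{\mu(B)}\le\phi_B(x)\le c_2\,\omega\big(\frac{\mu(B)}{d(x,B)}\big)\frac1{d(x,B)}$, $x\in X$. A family of balls $\mathscr G(x)\subset\mathscr B$ is complete at $x$ if $x\in B$ for any $B\in\mathscr G(x)$ and for any ball $A\ni x$ there is a ball $\bar A\in\mathscr G(x)$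 with $\bar A\supset A$, $\mu(\bar A)\le\eta\mu(A)$, where $\eta\ge1$ is a constant (denoted by the same letter as the doubling constant). $\langle f\rangle_{\phi_B}=\int_X\|f\|_{\mathbb U}\phi_B$ and $\mathcal M^{\phi,\mathscr G}f(x)=\sup_{B\in\mathscr G(x)}\langle f\rangle_{\phi_B}$, an operator acting from $L^r(X,\mathbb U)$ to the space $L^0(X,\mathbb R)$ of measurable functions. $a\lesssim b$ means $a\le c\,b$ with an admissible constant $c>0$, i.e. one depending only on $\mathcal K,\eta,r$.
   Formalization: The constant in ≲ may depend on the upper constant c₂ of the ω-regular family as well as on 𝒦, η, r; with dependence on 𝒦, η, r alone the claim is false, since replacing (ω, c₂) by (tω, c₂/t) keeps regularity while ‖ω‖ tends to 1. *)

(* Defs.v *)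
From HB Require Import structures.
From mathcomp Require Import all_boot all_order all_algebra.
From mathcomp Require Import all_classical all_reals all_analysis.

Set Implicit Arguments.
Unset Strict Implicit.
Unset Printing Implicit Defensive.

Import Order.TTheory GRing.Theory Num.Theory.
Import numFieldNormedType.Exports.

Local Open Scope classical_set_scope.
Local Open Scope ring_scope.

Section Bochner.
Context {d : measure_display} {X : measurableType d} {R : realType}
  {U : completeNormedModType R}.
Variable mu : {measure set X -> \bar R}.
Implicit Types (D : set X) (s f : X -> U).

Definition simple_function s : Prop :=
  finite_set (range s) /\ forall u, measurable (s @^-1` [set u]).

Definition strongly_measurable f : Prop :=
  exists s_ : (X -> U)^nat,
    (forall n, simple_function (s_ n)) /\
    (forall x, s_ n x @[n --> \oo] --> f x).

(* The value u = 0 contributes 0 whatever the measure of its fibre. *)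
Definition simple_integral D s : U :=
  \sum_(u \in range s) fine (mu (D `&` s @^-1` [set u])) *: u.

Definition has_bochner_integral D f (v : U) : Prop :=
  exists s_ : (X -> U)^nat,
    [/\ forall n, simple_function (s_ n),
        forall n, (mu (D `&` s_ n @^-1` (~` [set 0%R])) < +oo)%E,
        (\int[mu]_(x in D) (`|f x - s_ n x|)%:E)%E @[n --> \oo] --> 0%E &
        simple_integral D (s_ n) @[n --> \oo] --> v].

Definition bochner_integral D f : U :=
  xget 0 [set v | has_bochner_integral D f v].

(* Elements of L^r(X, U) are given by everywhere strongly measurable
   representatives. *)
Definition bochner_Lr (r : R) f : Prop :=
  strongly_measurable f /\ (\int[mu]_x (`|f x| `^ r)%:E < +oo)%E.

Definition average D f : U := (fine (mu D))^-1 *: bochner_integral D f.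

End Bochner.

Section BallBasis.
Context {d : measure_display} {X : measurableType d} {R : realType}.
Variables (mu : {measure set X -> \bar R}) (Balls : set (set X)).
Implicit Types (A B : set X) (x y : X).

(* The hull B^*. *)
Definition star B : set X :=
  \bigcup_(A in [set A | [/\ Balls A, (mu A <= 2%:E * mu B)%E &
                            A `&` B !=set0]]) A.

(* In the third clause a countable family stands for a finite or infinite
   sequence of balls; the last clause is separability. *)
Definition ball_basis (K : R) : Prop :=
  [/\ forall B, Balls B -> measurable B /\ (0 < mu B < +oo)%E,
      forall x y, exists2 B, Balls B & B x /\ B y,
      forall (E : set X) (e : R), measurable E -> 0 < e ->
        exists F : set (set X),
          [/\ countable F, F `<=` Balls &
              (mu (E `+` \bigcup_(A in F) A) < e%:E)%E],
      forall B, Balls B ->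
        exists2 B', Balls B' & star B `<=` B' /\ (mu B' <= K%:E * mu B)%E &
      forall F : set (set X), F `<=` Balls -> measurable (\bigcup_(A in F) A)].

Definition doubling (eta : R) : Prop :=
  forall B, Balls B -> star B <> [set: X] ->
    exists2 B', Balls B' & B `<` B' /\ (mu B' <= eta%:E * mu B)%E.

Definition volume_distance x B : R :=
  inf [set fine (mu A) | A in [set A | Balls A /\ B `|` [set x] `<=` A]].

Definition complete_at (eta : R) x (Gx : set (set X)) : Prop :=
  [/\ Gx `<=` Balls, forall B, Gx B -> B x &
      forall A, Balls A -> A x ->
        exists2 A', Gx A' & A `<=` A' /\ (mu A' <= eta%:E * mu A)%E].

Definition modulus_of_continuity (w : R -> R) : Prop :=
  [/\ forall t, 0 < t <= 1 -> 0 < w t <= 1,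
      forall s t, 0 < s -> s <= t -> t <= 1 -> w s <= w t &
      forall s t, 0 < s -> 0 < t -> s + t <= 1 -> w (s + t) <= w s + w t].

(* The upper constant c2 is a parameter, not existentially quantified: the
   regularity condition only involves the product of c2 and w, whereas the
   norm of w below is not homogeneous in w, so a bound in terms of that norm
   can only hold with a constant that depends on c2. *)
Definition omega_regular (w : R -> R) (c2 : R) (phi : set X -> X -> R) : Prop :=
  [/\ forall B, Balls B ->
        [/\ forall x, 0 <= phi B x,
            mu.-integrable [set: X] (EFin \o phi B) &
            (\int[mu]_x (`|phi B x|)%:E = 1)%E],
      exists gamma : R -> R,
        [/\ forall t, 1 <= t -> 1 <= gamma t,
            forall s t, 1 <= s -> s <= t -> gamma s <= gamma t &
            forall A B, Balls A -> Balls B -> B `<=` A -> forall x,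
              phi B x <= gamma (fine (mu A) / fine (mu B)) * phi A x],
      exists2 c1 : R, 0 < c1 &
        forall B, Balls B -> forall x,
          c1 * (\1_B x / fine (mu B)) <= phi B x &
      0 < c2 /\
        forall B, Balls B -> forall x,
          phi B x <= c2 * w (fine (mu B) / volume_distance x B)
                        / volume_distance x B].

Definition omega_norm (w : R -> R) : \bar R :=
  (1 + \int[lebesgue_measure]_(t in `]0%R, 1%R]) (w t * ln (t^-1) / t)%:E)%E.

(* Essential supremum of |g x - g x'| over E x E for the product measure.
   If g x and g x' are the same infinity, then |g x - g x'| = +oo. *)
Definition osc (E : set X) (g : X -> \bar R) : \bar R :=
  ereal_inf [set M | (mu \x mu)%E.-negligible
    [set p : X * X | [/\ E p.1, E p.2 & (M < `|g p.1 - g p.2|)%E]]].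

Definition osc_alpha (B : set X) (alpha : R) (g : X -> \bar R) : \bar R :=
  ereal_inf [set osc E g | E in
    [set E | [/\ measurable E, E `<=` B & (alpha%:E * mu B < mu E)%E]]].

Context {U : completeNormedModType R}.
Implicit Types f : X -> U.

Definition mean_osc (r : R) f B : \bar R :=
  (((fine (mu B))^-1%:E *
    \int[mu]_(x in B) (`|f x - average mu B f| `^ r)%:E) `^ (r^-1))%E.

Definition sharp_sup (r : R) f B : \bar R :=
  ereal_sup [set mean_osc r f A | A in [set A | Balls A /\ B `<=` A]].

Definition maximal (phi : set X -> X -> R) (G : X -> set (set X)) f (x : X) :
    \bar R :=
  ereal_sup [set (\int[mu]_y (`|f y| * phi B y)%:E)%E | B in G x].

End BallBasis.

(* Main.v *)
Require Import Defs.
From HB Require Import structures.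
From mathcomp Require Import all_boot all_order all_algebra finmap.
From mathcomp Require Import all_classical all_reals all_analysis.
From mathcomp Require Import measurable_realfun ring lra.

(* Fix the ball B. From a ball A one builds an increasing chain of balls
   C_0 = A, C_1, C_2, ... with C_n^* contained in C_(n+1), with comparable
   consecutive measures and with mu(C_n) >= 2^n mu(A) until the chain fills X.
   Off C_(n+1) the volume distance to A is at least mu(C_n), so phi_A is
   dominated by the sum over n of w(2^-n) 1_(C_n) / mu(C_n), and the averages of
   f over C_n and C_1 differ by O(n) times the sharp function. The weights
   n w(2^-n) are summable by the logarithmic Dini condition. Hence for a ball A
   that is large compared with B the phi_A-mean of |f| is close to the norm of
   the average of f over C_1, and it changes little when A is replaced by a
   comparable ball around another point of B. For a small ball A at x in B the
   phi_A-mean is close to the norm of the average over a fixed dilate B_1 of B,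
   unless x lies in a ball contained in B_1 on which f oscillates a lot around
   that average; by a Vitali covering argument the union of these exceptional
   balls has measure at most (1 - alpha) mu(B) / 2. *)

Set Implicit Arguments.
Unset Strict Implicit.
Unset Printing Implicit Defensive.

Import Order.TTheory GRing.Theory Num.Theory.
Import numFieldNormedType.Exports.

Local Open Scope classical_set_scope.
Local Open Scope ring_scope.

(** * Bochner integrals of finitely valued functions *)

Section FiniteValued.
Context {d : measure_display} {X : measurableType d} {R : realType}.
Variable mu : {measure set X -> \bar R}.

(** [simple_function] with an arbitrary codomain, so that pairs of simple functions and truth-valued
    tests fall under one notion. *)
Definition finite_valued (V : Type) (g : X -> V) : Prop :=
  finite_set (range g) /\ forall v, measurable (g @^-1` [set v]).

Lemma finite_valued_preimage (V : choiceType) (g : X -> V) (Y : set V) :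
  finite_valued g -> measurable (g @^-1` Y).
Proof.
move=> [fg mg].
rewrite (_ : _ @^-1` _ = \bigcup_(v in range g `&` Y) g @^-1` [set v]).
  apply: fin_bigcup_measurable => //.
  exact/finite_setIl.
apply/seteqP; split => [x Yx|x [v [_ Yv] /= ->]//].
by exists (g x).
Qed.

Lemma finite_valued_comp (V W : choiceType) (F : V -> W) (g : X -> V) :
  finite_valued g -> finite_valued (F \o g).
Proof.
move=> fg; split.
  rewrite -(image_comp g F); apply: finite_image. exact: (proj1 fg).
by move=> w; rewrite comp_preimage; exact: finite_valued_preimage.
Qed.

Lemma finite_valued_pair (V W : choiceType) (g : X -> V) (h : X -> W) :
  finite_valued g -> finite_valued h -> finite_valued (fun x => (g x, h x)).
Proof.
move=> fg fh; split.
  apply: (@sub_finite_set _ _ (range g `*` range h)).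
    by move=> _ [x _ <-]; split; exists x.
  by apply: finite_setX; [exact: (proj1 fg)|exact: (proj1 fh)].
move=> [v w].
rewrite (_ : _ @^-1` _ = g @^-1` [set v] `&` h @^-1` [set w]).
  by apply: measurableI; [exact: (proj2 fg)|exact: (proj2 fh)].
by apply/seteqP; split => x /= [-> ->].
Qed.

Lemma finite_valued_measurable (V : choiceType) (g : X -> V) d'
    (T : measurableType d') (k : V -> T) :
  finite_valued g -> measurable_fun setT (k \o g).
Proof.
move=> fg _ Y mY; rewrite setTI comp_preimage.
exact: finite_valued_preimage.
Qed.

Lemma integral_finite_valued (V : choiceType) (g : X -> V) (D : set X)
    (k : V -> R) :
  measurable D -> finite_valued g -> (forall v, 0 <= k v) ->
  (\int[mu]_(x in D) (k (g x))%:E =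
   \sum_(v \in range g) (k v)%:E * mu (D `&` g @^-1` [set v]))%E.
Proof.
move=> mD fg k0.
have E x : ((k (g x))%:E =
    \sum_(v \in range g) (k v)%:E * (\1_(g @^-1` [set v]) x)%:E)%E.
  rewrite (@fsbigD1 _ _ _ _ (g x)) //=; last 2 first.
  - exact: (proj1 fg).
  - by exists x.
  rewrite indicE mem_set//= mule1 fsbig1 ?adde0// => v [_ /= vx].
  by rewrite indicE memNset ?mule0//= => gv; exact/vx.
under eq_integral do rewrite E.
rewrite ge0_integral_fsum //.
- apply: eq_fsbigr => v _; rewrite ge0_integralZl_EFin//.
  + by rewrite integral_indic// 1?setIC//; exact: (proj2 fg).
  + by apply/measurable_EFinP/measurable_indic; exact: (proj2 fg).
- move=> v; apply: emeasurable_funM => //.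
  by apply/measurable_EFinP/measurable_indic; exact: (proj2 fg).
- by move=> v x _; rewrite mule_ge0// lee_fin.
- exact: (proj1 fg).
Qed.

Section SimpleIntegral.
Context {U : completeNormedModType R}.

(** A fibre of [F \o g] is a finite disjoint union of fibres of [g]. This lets two simple functions
    be integrated over a common partition. *)
Lemma simple_integral_comp (V : choiceType) (F : V -> U) (g : X -> V)
    (D : set X) :
  measurable D -> (mu D < +oo)%E -> finite_valued g ->
  simple_integral mu D (F \o g) =
    \sum_(v \in range g) fine (mu (D `&` g @^-1` [set v])) *: F v.
Proof.
move=> mD Doo fg; rewrite /simple_integral.
have fin A : measurable A -> mu (D `&` A) \is a fin_num.
  move=> mA; rewrite ge0_fin_numE//; apply: le_lt_trans Doo.
  by apply: le_measure; rewrite ?inE//=; exact: measurableI.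
have fr := (proj1 fg).
rewrite -(image_comp g F) fsbig_finite; last exact: finite_image.
rewrite fset_set_image// fsbig_finite//=.
rewrite (partition_big_imfset _ F)/=.
apply: eq_big_seq => w _.
rewrite [RHS](_ : _ = \sum_(v <- fset_set (range g) | F v == w)
    fine (mu (D `&` g @^-1` [set v])) *: w); last first.
  by apply: eq_bigr => v /eqP ->.
rewrite -scaler_suml; congr (_ *: _).
rewrite (_ : _ `&` _ = \bigcup_(v in range g `&` F @^-1` [set w])
    (D `&` g @^-1` [set v])); last first.
  apply/seteqP; split => [x [Dx /= gx]|x [v [_ /= vw] [Dx /= gx]]].
    by exists (g x) => //; split => //; exists x.
  by split => //=; rewrite gx.
rewrite measure_fin_bigcup//; first last.
- by move=> v _; apply: measurableI => //; exact: (proj2 fg).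
- by move=> v v' _ _ [x [[_ /= <-] [_ /= <-]]].
- exact: finite_setIl.
rewrite fsbig_mkcondr fsbig_finite//= -sum_fine; last first.
  by move=> v _; case: ifPn => // _; apply: fin; exact: (proj2 fg).
rewrite [RHS]big_mkcond/=; apply: eq_bigr => v _.
rewrite (fun_if fine); congr (if _ then _ else _).
by apply/idP/eqP; rewrite inE.
Qed.

(** With [g = (s, t)] both integrals become sums over the same fibres, and the triangle inequality
    applies term by term. *)
Lemma simple_integral_sub_le (s t : X -> U) (D : set X) :
  measurable D -> (mu D < +oo)%E -> finite_valued s -> finite_valued t ->
  (`|simple_integral mu D s - simple_integral mu D t|%:E <=
   \int[mu]_(x in D) (`|s x - t x|)%:E)%E.
Proof.
move=> mD Doo fs ft.
pose g x := (s x, t x).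
have fg : finite_valued g by exact: finite_valued_pair.
have -> : s = fst \o g by [].
have -> : t = snd \o g by [].
rewrite !simple_integral_comp//.
rewrite [leRHS](_ : _ = \int[mu]_(x in D) ((fun p : U * U => `|p.1 - p.2|) (g x))%:E)%E//.
rewrite (@integral_finite_valued _ g D (fun p : U * U => `|p.1 - p.2|))//.
have fr := proj1 fg; rewrite !(fsbig_finite _ _ fr).
rewrite -sumrB/=.
rewrite (eq_bigr (fun p => ((fine (mu (D `&` g @^-1` [set p]))) * `|p.1 - p.2|)%:E)); last first.
  move=> p _; rewrite EFinM muleC fineK// ge0_fin_numE//.
  apply: le_lt_trans Doo; apply: le_measure; rewrite ?inE//.
    by apply: measurableI => //; exact: (proj2 fg).
rewrite sumEFin lee_fin; apply: le_trans (ler_norm_sum _ _ _) _.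
by apply: ler_sum => p _; rewrite -scalerBr normrZ ger0_norm.
Qed.

Lemma simple_integral_cst (c : U) (D : set X) :
  measurable D -> (mu D < +oo)%E ->
  simple_integral mu D (cst c) = fine (mu D) *: c.
Proof.
move=> mD Doo.
have ft : finite_valued (fun _ : X => tt).
  split; first exact: finite_finset.
  by move=> []; rewrite (_ : _ @^-1` _ = setT)//; apply/seteqP; split.
rewrite -[cst c]/((fun _ => c) \o (fun _ : X => tt)) simple_integral_comp//.
have [[x _]|X0] := pselect ([set: X] !=set0).
  rewrite (_ : range _ = [set tt]).
    rewrite fsbig_set1 (_ : _ @^-1` _ = setT) ?setIT//.
    by apply/seteqP; split.
  by apply/seteqP; split => [[]//|[] _]; exists x.
rewrite (_ : D = set0); last by apply/seteqP; split => // x; case: X0; exists x.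
rewrite measure0/= scale0r fsbig1// => u _.
by rewrite set0I measure0 scale0r.
Qed.

End SimpleIntegral.
End FiniteValued.

(** * Bochner averages *)

Section BochnerAverage.
Context {d : measure_display} {X : measurableType d} {R : realType}
  {U : completeNormedModType R}.
Variable mu : {measure set X -> \bar R}.
Implicit Types (f : X -> U) (D : set X).

Lemma strongly_measurable_norm_sub f (g : X -> U) D :
  strongly_measurable f -> finite_valued g ->
  measurable_fun D (fun x => `|f x - g x|).
Proof.
move=> [s [ss sf]] fg; apply: measurable_funTS.
apply: (@measurable_fun_cvg _ _ _ _ (fun n x => `|s n x - g x|)) => [n|x _].
  exact: (@finite_valued_measurable _ _ _ _ _ _
    (fun p : U * U => `|p.1 - p.2|) (finite_valued_pair (ss n) fg)).
by apply: cvg_norm; apply: cvgB; [exact: sf|exact: cvg_cst].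
Qed.

Lemma finite_valued_cst (V : Type) (v : V) : finite_valued (cst v : X -> V).
Proof.
split=> [|w]; last by rewrite preimage_cst; case: ifP.
by apply: (@sub_finite_set _ _ [set v]) => // _ [x _ <-].
Qed.

Lemma strongly_measurable_norm_sub_cst f (c : U) D :
  strongly_measurable f -> measurable_fun D (fun x => `|f x - c|).
Proof. by move=> mf; exact/strongly_measurable_norm_sub/finite_valued_cst. Qed.

Lemma strongly_measurable_norm f D :
  strongly_measurable f -> measurable_fun D (fun x => `|f x|).
Proof.
move=> /(@strongly_measurable_norm_sub_cst _ 0 D).
by under eq_fun do rewrite subr0.
Qed.

(** The approximants are set to 0 wherever their norm exceeds 2|f x|. Convergence survives: where f
    x is nonzero the cut is eventually inactive, and where f x = 0 it returns 0. *)
Lemma strongly_measurable_dominated f : strongly_measurable f ->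
  exists t : (X -> U)^nat,
  [/\ forall n, finite_valued (t n),
      forall x, t n x @[n --> \oo] --> f x &
      forall n x, `|t n x| <= 2 * `|f x|].
Proof.
move=> smf; have mf := strongly_measurable_norm (D := setT) smf.
have [s [ss sf]] := smf.
pose F (p : U * bool) : U := if p.2 then p.1 else 0.
exists (fun n => F \o (fun x => (s n x, `|s n x| <= 2 * `|f x|))); split => /=.
- move=> n; apply: finite_valued_comp; apply: finite_valued_pair; [exact: ss|split].
    exact: finite_finset.
  move=> b.
  have : measurable_fun setT (fun x => `|s n x| <= 2 * `|f x|).
    apply: measurable_fun_ler.
      exact: (@finite_valued_measurable _ _ _ (s n) _ _ (@Num.norm _ U) (ss n)).
    exact: measurable_funM.
  by move=> /(_ measurableT [set b] Logic.I); rewrite setTI.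
- move=> x; have [fx0|fx0] := eqVneq (f x) 0.
    rewrite fx0; apply: cvg_near_cst; apply: nearW => n.
    by rewrite /F/= normr0 mulr0 normr_le0; case: ifPn => // /eqP ->.
  apply: (cvg_trans _ (sf x)); apply: near_eq_cvg.
  have fp : 0 < `|f x| by rewrite normr_gt0.
  have h : \forall n \near \oo, `|f x - s n x| < `|f x|.
    exact: cvgr_dist_lt (sf x) _ fp.
  near=> n.
  rewrite /F/= ifT//.
  have : `|f x - s n x| < `|f x| by near: n.
  by have := ler_distD (f x) (s n x) 0; rewrite !subr0 (distrC (s n x)); lra.
- move=> n x; rewrite /F/=; case: ifPn => //.
  by rewrite normr0 mulr_ge0.
Unshelve. all: by end_near. Qed.

(** Dominated convergence with majorant 3|f| gives convergence of the truncated approximants in the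
    mean, so their integrals form a Cauchy sequence in the complete space [U]. *)
Lemma has_bochner_integral_exists f D :
  measurable D -> (mu D < +oo)%E -> strongly_measurable f ->
  (\int[mu]_(x in D) `|f x|%:E < +oo)%E ->
  exists v, has_bochner_integral mu D f v.
Proof.
move=> mD Doo smf intf.
have [t [ft tf tle]] := strongly_measurable_dominated smf.
have mft n : measurable_fun D (fun x => `|f x - t n x|).
  exact: strongly_measurable_norm_sub.
have mf := strongly_measurable_norm (D := D) smf.
have I0 : (\int[mu]_(x in D) (`|f x - t n x|)%:E)%E @[n --> \oo] --> 0%E.
  have [| | |_ _] := @dominated_convergence _ _ _ mu D mD
    (fun n x => (`|f x - t n x|)%:E) (cst 0%E) (fun x => (3 * `|f x|)%:E)
    (fun n => (measurable_EFinP _ _).2 (mft n)) (measurable_cst _).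
  - apply: aeW => x _; apply: cvg_EFin; first exact: nearW.
    rewrite (_ : 0 = `|f x - f x|); last by rewrite subrr normr0.
    by apply: cvg_norm; apply: cvgB; [exact: cvg_cst|exact: tf].
  - apply/integrableP; split; first by apply/measurable_EFinP; exact: measurable_funM.
    under eq_integral do rewrite /= ger0_norm ?mulr_ge0// EFinM.
    rewrite ge0_integralZl_EFin//; last exact/measurable_EFinP.
    exact: lte_mul_pinfty.
  - apply: aeW => x n _ /=; rewrite lee_fin normr_id.
    by have := ler_normB (f x) (t n x); have := tle n x; lra.
  - by rewrite integral0.
have tri m n : (`|simple_integral mu D (t m) - simple_integral mu D (t n)|%:E <=
    \int[mu]_(x in D) (`|f x - t m x|)%:E + \int[mu]_(x in D) (`|f x - t n x|)%:E)%E.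
  apply: le_trans (simple_integral_sub_le mD Doo (ft m) (ft n)) _.
  rewrite -ge0_integralD//; try exact/measurable_EFinP.
  apply: ge0_le_integral => //.
  - apply/measurable_EFinP/measurable_funTS.
    exact: (@finite_valued_measurable _ _ _ _ _ _
      (fun p : U * U => `|p.1 - p.2|) (finite_valued_pair (ft m) (ft n))).
  - by apply: emeasurable_funD; exact/measurable_EFinP.
  - by move=> x _; rewrite -EFinD lee_fin (distrC (f x) (t m x)) ler_distD.
have : cvg (simple_integral mu D (t n) @[n --> \oo]).
  apply/cauchy_cvgP/cauchy_exP => e e0.
  have e20 : (0 < (e / 2)%:E)%E by rewrite lte_fin divr_gt0.
  have [N _ NI] : \forall n \near \oo,
      (\int[mu]_(x in D) (`|f x - t n x|)%:E < (e / 2)%:E)%E.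
    exact: I0 _ (open_ereal_lt' e20).
  exists (simple_integral mu D (t N)); exists N => // n /= Nn.
  rewrite -ball_normE/ball_/= -lte_fin; apply: le_lt_trans (tri _ _) _.
  rewrite (splitr e) EFinD lteD//; apply: NI => //=.
move=> /cvg_ex[v tv]; exists v, t; split => // n.
apply: le_lt_trans Doo; apply: le_measure; rewrite ?inE//.
by apply: measurableI => //; exact: finite_valued_preimage.
Qed.

(** Since mu(D) c is the simple integral of the constant c, [simple_integral_sub_le] gives the bound
    for an approximant of f, hence for f up to [e]. *)
Lemma average_sub_le f D (c : U) :
  measurable D -> (mu D < +oo)%E -> strongly_measurable f ->
  (\int[mu]_(x in D) `|f x|%:E < +oo)%E ->
  ((fine (mu D) * `|average mu D f - c|)%:E <=
   \int[mu]_(x in D) (`|f x - c|)%:E)%E.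
Proof.
move=> mD Doo smf intf.
have [w hw] := has_bochner_integral_exists mD Doo smf intf.
rewrite /average/bochner_integral.
(* The bound is proved for whichever value [xget] selects; the existence of an integral rules out
   the default 0. *)
case: xgetP => [v _ [s [fs sfin s0 sv]]|/(_ w)//].
have [D0|Dneq0] := eqVneq (fine (mu D)) 0.
  by rewrite D0 mul0r integral_ge0// => x _; rewrite lee_fin.
have -> : fine (mu D) * `|(fine (mu D))^-1 *: v - c| = `|v - fine (mu D) *: c|.
  by rewrite -[X in X * _]ger0_norm// -normrZ scalerBr scalerA divff// scale1r.
have mfc : measurable_fun D (fun x => `|f x - c|).
  exact: strongly_measurable_norm_sub_cst.
apply/lee_addgt0Pr => e e0.
have e2 : 0 < e / 2 by rewrite divr_gt0.
have e20 : (0 < (e / 2)%:E)%E by rewrite lte_fin.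
have [n [sn In]] : exists n, `|v - simple_integral mu D (s n)| < e / 2 /\
    (\int[mu]_(x in D) (`|f x - s n x|)%:E < (e / 2)%:E)%E.
  have sv2 : \forall n \near \oo, `|v - simple_integral mu D (s n)| < e / 2.
    exact: cvgr_dist_lt sv _ e2.
  have s02 := s0 _ (open_ereal_lt' e20).
  near \oo => n; exists n; split; first by near: n.
  by near: n; exact: s02.
have h := ler_distD (simple_integral mu D (s n)) v (fine (mu D) *: c).
apply: (@le_trans _ _ (`|simple_integral mu D (s n) - fine (mu D) *: c|%:E + (e / 2)%:E)%E).
  by rewrite -EFinD lee_fin; lra.
rewrite [in leRHS](splitr e) EFinD addeA leeD2r//.
rewrite -simple_integral_cst//.
have fcst := finite_valued_cst c.
apply: le_trans (simple_integral_sub_le mD Doo (fs n) fcst) _.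
apply: (@le_trans _ _ (\int[mu]_(x in D) (`|f x - c|)%:E +
    \int[mu]_(x in D) (`|f x - s n x|)%:E)%E); last first.
  by rewrite leeD2l// ltW.
have ms : measurable_fun D (fun x => `|s n x - c|).
  apply: measurable_funTS.
  exact: (@finite_valued_measurable _ _ _ (s n) _ _ (fun u => `|u - c|) (fs n)).
have mfs : measurable_fun D (fun x => `|f x - s n x|).
  exact: (strongly_measurable_norm_sub (D := D) smf (fs n)).
rewrite -ge0_integralD//; try exact/measurable_EFinP.
apply: ge0_le_integral => //; first exact/measurable_EFinP.
  by apply: emeasurable_funD; exact/measurable_EFinP.
by move=> x _; rewrite -EFinD lee_fin [leRHS]addrC (distrC (f x) (s n x)) ler_distD.
Unshelve. all: by end_near. Qed.

End BochnerAverage.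

(** * Chains of balls *)

Section BallGeometry.
Context {d : measure_display} {X : measurableType d} {R : realType}.
Variables (mu : {measure set X -> \bar R}) (Balls : set (set X)) (K eta : R).
Hypothesis bb : ball_basis mu Balls K.
Implicit Types (A B C D : set X) (x y : X).

Local Notation m A := (fine (mu A)).

Lemma ball_measurable A : Balls A -> measurable A.
Proof. by have [h _ _ _ _] := bb; case/h. Qed.

Lemma ball_gt0 A : Balls A -> 0 < m A.
Proof. by have [h _ _ _ _] := bb; case/h => _; exact: fine_gt0. Qed.

Lemma ball_lty A : Balls A -> (mu A < +oo)%E.
Proof. by have [h _ _ _ _] := bb; case/h => _ /andP[]. Qed.

Lemma ballE A : Balls A -> mu A = (m A)%:E.
Proof. by move=> BA; rewrite fineK// ge0_fin_numE// ball_lty. Qed.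

Lemma ball_nonempty A : Balls A -> A !=set0.
Proof.
move=> BA; apply/set0P/eqP => A0.
by have := ball_gt0 BA; rewrite A0 measure0 ltxx.
Qed.

Lemma ball_le A B : Balls A -> Balls B -> A `<=` B -> m A <= m B.
Proof.
move=> BA BB AB; rewrite -lee_fin -!ballE//.
by apply: le_measure; rewrite ?inE//; exact: ball_measurable.
Qed.

Lemma sub_star A B : Balls A -> Balls B -> m A <= 2 * m B -> A `&` B !=set0 ->
  A `<=` star mu Balls B.
Proof.
move=> BA BB AB AB0; apply: bigcup_sup; split => //.
by rewrite (ballE BA) (ballE BB) -EFinM lee_fin.
Qed.

Lemma sub_star_sub A B : Balls A -> Balls B -> m A <= 2 * m B -> B `<=` A ->
  A `<=` star mu Balls B.
Proof.
move=> BA BB AB /setIidr BA'; apply: sub_star => //.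
by rewrite BA'; exact: ball_nonempty.
Qed.

Lemma star_refl B : Balls B -> B `<=` star mu Balls B.
Proof.
by move=> BB; apply: sub_star_sub => //; have := ball_gt0 BB; lra.
Qed.

Lemma ball_hull B : Balls B ->
  exists2 C, Balls C & star mu Balls B `<=` C /\ m C <= K * m B.
Proof.
move=> BB; have [_ _ _ h _] := bb; have [C BC [BsC CB]] := h _ BB.
by exists C => //; split => //; rewrite -lee_fin EFinM -!ballE.
Qed.

Lemma hull_constant_ge1 B : Balls B -> 1 <= K.
Proof.
move=> BB; have [C BC [BC' CB]] := ball_hull BB.
have h := ball_le BB BC (subset_trans (star_refl BB) BC').
by rewrite -(ler_pM2r (ball_gt0 BB)) mul1r (le_trans h).
Qed.

(** [K ^+ 2] is the cost of two hulls, and eta |K| that of a hull followed by a doubling step. The 1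
    and the absolute value make [L] at least 1 before any ball is at hand to show [1 <= K]. *)
Definition chain_constant : R := 1 + eta * `|K| + K ^+ 2.

Local Notation L := chain_constant.

Hypothesis eta1 : 1 < eta.
Hypothesis dbl : doubling mu Balls eta.

Let eta0 : 0 <= eta.
Proof. exact: le_trans ler01 (ltW eta1). Qed.

Lemma chain_constant_ge1 : 1 <= L.
Proof.
by rewrite /chain_constant -addrA lerDl addr_ge0 ?sqr_ge0 ?mulr_ge0.
Qed.

(* A strictly larger ball around the hull of B cannot have measure at most
   2 mu(B), for it would then be contained in B^*. *)
Lemma ball_successor B : Balls B ->
  exists C, [/\ Balls C, star mu Balls B `<=` C, m C <= L * m B &
               C = setT \/ 2 * m B <= m C].
Proof.
move=> BB; have K1 := hull_constant_ge1 BB.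
have mB := ball_gt0 BB.
have [H BH [BH' HB]] := ball_hull BB.
(* If H^* is all of X, then so is the hull of H; otherwise doubling enlarges H strictly. *)
have [HT|HT] := pselect (star mu Balls H = setT).
  have [H2 BH2 [H2' H2H]] := ball_hull BH.
  exists H2; split => //.
  - by apply: subset_trans BH' _; apply: subset_trans (star_refl BH) _.
  - apply: (le_trans H2H); apply: (@le_trans _ _ (K * (K * m B))).
      by rewrite ler_pM2l//; lra.
    rewrite mulrA ler_pM2r// /chain_constant expr2 lerDr addr_ge0//.
    exact: mulr_ge0.
  - by left; apply/seteqP; split => // x _; apply: H2'; rewrite HT.
have [C BC [[HC CH] CmH]] := dbl BH HT.
have CE : m C <= eta * m H by rewrite -lee_fin EFinM -!ballE.
exists C; split => //.
- exact: subset_trans BH' HC.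
- apply: (le_trans CE); apply: (@le_trans _ _ (eta * (K * m B))).
    exact: ler_wpM2l.
  rewrite mulrA ler_pM2r// /chain_constant ger0_norm//; last lra.
  by rewrite addrAC lerDr addr_ge0 ?sqr_ge0.
- right; rewrite leNgt; apply/negP => CB; apply: CH.
  apply: (subset_trans _ BH'); apply: sub_star_sub => //; first exact: ltW.
  exact: subset_trans (star_refl BB) (subset_trans BH' HC).
Qed.

Definition ball_chain A (C : nat -> set X) : Prop :=
  [/\ C 0%N = A, forall n, Balls (C n),
      forall n, star mu Balls (C n) `<=` C n.+1,
      forall n, m (C n.+1) <= L * m (C n) &
      forall n, C n = setT \/ 2 ^+ n * m A <= m (C n)].

Lemma ball_chain_exists A : Balls A -> exists C : nat -> set X, ball_chain A C.
Proof.
move=> BA.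
have /choice[next nextP] : forall B, exists C, Balls B ->
    [/\ Balls C, star mu Balls B `<=` C, m C <= L * m B &
        C = setT \/ 2 * m B <= m C].
  move=> B; have [/ball_successor[C CP]|nB] := pselect (Balls B).
    by exists C.
  by exists B.
pose C n := iter n next A; exists C.
have BC n : Balls (C n) by elim: n => // n /nextP[].
have sC n : star mu Balls (C n) `<=` C n.+1 by have [] := nextP _ (BC n).
split => // [n|]; first by have [] := nextP _ (BC n).
elim=> [|n [CT|ih]]; first by right; rewrite expr0 mul1r.
  left; apply/seteqP; split => // x _; apply: (sC n); apply: star_refl => //.
  by rewrite CT.
have [_ _ _ [CT|h]] := nextP _ (BC n); [by left|right].
by apply: le_trans h; rewrite exprS -mulrA ler_pM2l.
Qed.

(** * Exhaustion of the space and volume distance along a chain *)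

Section Chain.
Variables (A : set X) (C : nat -> set X).
Hypothesis chainC : ball_chain A C.

Lemma chain_ball n : Balls (C n).
Proof. by have [_ + _ _ _] := chainC; apply. Qed.

Lemma chain_le n : m (C n.+1) <= L * m (C n).
Proof. by have [_ _ _ + _] := chainC; apply. Qed.

Lemma chain_star n : star mu Balls (C n) `<=` C n.+1.
Proof. by have [_ _ + _ _] := chainC; apply. Qed.

Lemma chainS n : C n `<=` C n.+1.
Proof. by move=> x Cx; apply: chain_star; exact: (star_refl (chain_ball n)). Qed.

Lemma chain_sub n k : (n <= k)%N -> C n `<=` C k.
Proof.
elim: k => [|k ih]; first by rewrite leqn0 => /eqP ->.
rewrite leq_eqVlt => /predU1P[->//|/ih nk].
exact: subset_trans nk (@chainS _).
Qed.

Lemma chain_sub0 n : A `<=` C n.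
Proof. by have [<- _ _ _ _] := chainC; exact: chain_sub. Qed.

Lemma chain_ball0 : Balls A.
Proof. by have [<- _ _ _ _] := chainC; exact: chain_ball. Qed.

(** A ball through y and a point of A has measure at most 2^n mu(A) for large n, so it lies in C_n^*
    and thus in C_(n+1), unless C_n is already X. *)
Lemma chain_cover y : exists n, C n y.
Proof.
have BA := chain_ball0.
have [a Aa] := ball_nonempty BA.
have [_ h _ _ _] := bb; have [D BD [Da Dy]] := h a y.
have mA := ball_gt0 BA; have mD := ball_gt0 BD.
pose n := Num.bound (m D / m A).
have [_ _ _ _ /(_ n)[CT|Cn]] := chainC; first by exists n; rewrite CT.
exists n.+1; apply: chain_star; apply: sub_star Dy => //.
- exact: chain_ball.
- suff : m D <= 2 ^+ n * m A by have := ball_gt0 (chain_ball n); lra.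
  rewrite -ler_pdivrMr//; apply: (@le_trans _ _ n%:R).
    by rewrite ltW// archi_boundP// divr_ge0// ltW.
  by rewrite -natrX ler_nat ltnW// ltn_expl.
- by exists a; split => //; exact: chain_sub0.
Qed.

(** The infimum of an empty set would be a default value, so a competing ball has to be exhibited: a
    term of the chain that contains y. *)
Lemma volume_distance_ge (t : R) y :
  (forall D, Balls D -> A `<=` D -> D y -> t <= m D) ->
  t <= volume_distance mu Balls y A.
Proof.
move=> h; apply: lb_le_inf => [|_ [D [BD AyD] <-]].
  have [n Cy] := chain_cover y; exists (m (C n)); exists (C n) => //.
  split; first exact: chain_ball.
  by move=> z [|->//]; exact: chain_sub0.
by apply: h => // [z Az|]; apply: AyD; [left|right].
Qed.

(** A ball containing A and y of measure below mu(C_n) would lie in C_n^* and so put y in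
    C_(n+1). *)
Lemma volume_distance_chain_ge n y : ~ C n.+1 y ->
  m (C n) <= volume_distance mu Balls y A.
Proof.
move=> Cy; apply: volume_distance_ge => D BD AD Dy.
rewrite leNgt; apply/negP => DC; apply: Cy; apply: chain_star.
have := ball_gt0 (chain_ball n) => mC.
apply: sub_star Dy => //; [exact: chain_ball|lra|].
have [a Aa] := ball_nonempty chain_ball0.
by exists a; split; [exact: AD|exact: chain_sub0].
Qed.

End Chain.
End BallGeometry.

(** * Domination of the kernels along a chain *)

Section KernelBound.
Context {d : measure_display} {X : measurableType d} {R : realType}.
Variables (mu : {measure set X -> \bar R}) (Balls : set (set X)) (K eta : R).
Hypothesis bb : ball_basis mu Balls K.
Hypothesis eta1 : 1 < eta.
Variables (w : R -> R) (c2 : R) (phi : set X -> X -> R).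
Hypothesis mw : modulus_of_continuity w.
Hypothesis reg : omega_regular mu Balls w c2 phi.

Local Notation m A := (fine (mu A)).
Local Notation L := (chain_constant K eta).

Let c2_gt0 : 0 < c2.
Proof. by have [_ _ _ []] := reg. Qed.

Let w_gt0 n : 0 < w (2 ^- n).
Proof.
have [h _ _] := mw; have /h/andP[]// : 0 < (2 ^- n : R) <= 1.
by rewrite invr_gt0 exprn_gt0//= invf_le1 ?exprn_gt0// exprn_ege1// ler1n.
Qed.

Section Pointwise.
Variables (A : set X) (C : nat -> set X).
Hypothesis chainC : ball_chain mu Balls K eta A C.

Let chain_gt0 n : 0 < m (C n).
Proof. exact: (ball_gt0 bb (chain_ball chainC n)). Qed.

(** Both w(mu(A)/d) and 1/d are nonincreasing in the distance d, so d may be replaced by the lower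
    bound mu(C_n), and mu(A)/mu(C_n) is at most 2^-n. *)
Let kernel_le_scale n y : 2 ^+ n * m A <= m (C n) ->
  m (C n) <= volume_distance mu Balls y A ->
  phi A y <= c2 * w (2 ^- n) / m (C n).
Proof.
move=> nC Cd; have [_ _ _ [_ ub]] := reg.
have BA := chain_ball0 chainC; have mA := ball_gt0 bb BA.
have mC := chain_gt0 n; have d0 := lt_le_trans mC Cd.
apply: (le_trans (ub _ BA y)).
apply: ler_pM => //.
- rewrite mulr_ge0 ?(ltW c2_gt0)//.
  have [h _ _] := mw; have /h/andP[/ltW//] : 0 < m A / volume_distance mu Balls y A <= 1.
  rewrite divr_gt0//= ler_pdivrMr// mul1r; apply: le_trans Cd.
  exact: (ball_le bb BA (chain_ball chainC n) (@chain_sub0 _ _ _ _ _ _ _ bb _ _ chainC n)).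
- by rewrite invr_ge0 ltW.
- rewrite ler_pM2l//; have [_ + _] := mw; apply; first by rewrite divr_gt0.
    rewrite ler_pdivrMr// mulrC -ler_pdivrMr ?invr_gt0 ?exprn_gt0// invrK.
    by rewrite mulrC (le_trans nC).
  by rewrite invf_le1 ?exprn_gt0// exprn_ege1// ler1n.
- by rewrite lef_pV2 ?posrE.
Qed.

Let transfer n a : 0 <= a -> a / m (C n) <= a * L ^+ 2 / m (C n.+2).
Proof.
move=> a0; rewrite -mulrA ler_wpM2l// ler_pdivlMr// ler_pdivrMl// mulrC.
have L1 := chain_constant_ge1 K eta1.
apply: (le_trans (chain_le chainC _)); rewrite expr2 -mulrA ler_pM2l; last by lra.
exact: (chain_le chainC n).
Qed.

(** If y lies in C_1, scale 0 is used, as the distance is at least mu(A). Otherwise y enters the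
    chain at some C_(k+2), the distance is at least mu(C_k), and j = k + 1; passing from C_k to
    C_(k+2) costs L^2. The predecessor [j.-1] is 0 for both j = 0 and j = 1. *)
Lemma kernel_le y : exists j, C j.+1 y /\
  phi A y <= c2 * L ^+ 2 * w (2 ^- j.-1) / m (C j.+1).
Proof.
have L1 := chain_constant_ge1 K eta1.
have cw n : 0 <= c2 * w (2 ^- n) by rewrite mulr_ge0 ?ltW.
have [C1y|C1y] := pselect (C 1%N y).
  exists 0%N; split => //=.
  have C0 : C 0%N = A by have [] := chainC.
  apply: (@le_trans _ _ (c2 * w (2 ^- 0) / m (C 0%N))).
    apply: kernel_le_scale; first by rewrite C0 expr0 mul1r.
    apply: (volume_distance_ge bb chainC) => D BD AD Dy.
    by rewrite C0; apply: (ball_le bb) => //; exact: (chain_ball0 chainC).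
  rewrite [leRHS](_ : _ = c2 * w (2 ^- 0) * (L ^+ 2 / m (C 1%N))); last by ring.
  rewrite ler_wpM2l// ler_pdivlMr// ler_pdivrMl// mulrC.
  apply: (le_trans (chain_le chainC _)); rewrite ler_pM2r// expr2.
  by rewrite ler_peMl//; lra.
have [n Cn] := chain_cover bb chainC y.
have [k [Ck CSk]] : exists k, ~ C k.+1 y /\ C k.+2 y.
  elim: n Cn => [|n ih Cn]; first by move=> /(chainS bb chainC).
  have [/ih//|nC] := pselect (C n y).
  by case: n Cn nC {ih} => // n Cn nC; exists n.
exists k.+1; split => //=.
apply: (@le_trans _ _ (c2 * w (2 ^- k) / m (C k))).
  apply: kernel_le_scale; last exact: (volume_distance_chain_ge bb chainC).
  have [_ _ _ _ /(_ k)[CT|//]] := chainC.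
  by case: Ck; apply: (chainS bb chainC); rewrite CT.
by rewrite (mulrAC c2 (L ^+ 2)); exact: transfer.
Qed.

End Pointwise.

(** The majorant of phi_A given by [kernel_le] is integrated term by term, and its factor
    1/mu(C_(j+1)) cancels the measure in the hypothesis on [h]. The linear growth in j leaves room
    for the drift of averages along the chain. *)
Lemma kernel_integral_le (A : set X) (C : nat -> set X) (h : X -> R) (T W : R) :
  ball_chain mu Balls K eta A C ->
  measurable_fun setT h -> (forall x, 0 <= h x) ->
  (forall j, \int[mu]_(x in C j.+1) (h x)%:E <= (T * j.+1%:R * m (C j.+1))%:E)%E ->
  0 <= T ->
  (\sum_(0 <= j <oo) (j.+1%:R * w (2 ^- j.-1))%:E <= W%:E)%E ->
  (\int[mu]_x (h x * phi A x)%:E <= (c2 * L ^+ 2 * T * W)%:E)%E.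
Proof.
move=> chainC mh h0 hC T0 hW.
have L1 := chain_constant_ge1 K eta1.
have BC n := chain_ball chainC n.
have mC n := ball_measurable bb (BC n).
have C0 n := ball_gt0 bb (BC n).
pose a j := c2 * L ^+ 2 * w (2 ^- j.-1) / m (C j.+1).
have cL0 : 0 <= c2 * L ^+ 2 by rewrite mulr_ge0 ?sqr_ge0// ltW.
have a0 j : 0 <= a j by rewrite /a divr_ge0// mulr_ge0// ltW.
pose u j x := ((a j)%:E * ((h x)%:E * (\1_(C j.+1) x)%:E))%E.
have u0 j x : (0 <= u j x)%E.
  by apply: mule_ge0; [rewrite lee_fin|apply: mule_ge0; rewrite lee_fin].
have mhC j : measurable_fun setT (fun x => (h x)%:E * (\1_(C j.+1) x)%:E)%E.
  by apply: emeasurable_funM; apply/measurable_EFinP => //; exact: measurable_indic.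
have mu_ j : measurable_fun setT (u j).
  by apply: emeasurable_funM.
have mphi : measurable_fun setT (phi A).
  have [hphi _ _ _] := reg; have [_ /integrableP[/measurable_EFinP]] := hphi _ (chain_ball0 chainC).
  by [].
apply: (@le_trans _ _ (\int[mu]_x \sum_(0 <= j <oo) u j x)%E).
  apply: ge0_le_integral => //.
  - move=> x _; rewrite lee_fin mulr_ge0//.
    by have [hphi _ _ _] := reg; have [] := hphi _ (chain_ball0 chainC).
  - by apply/measurable_EFinP; exact: measurable_funM.
  - exact: ge0_emeasurable_sum.
  (* A single term of the nonnegative series already dominates the integrand at x. *)
  - move=> x _; have [j [Cj phij]] := kernel_le chainC x.
    apply: le_trans (nneseries_lim_ge j.+1 _) => //.
    rewrite big_nat_recr//=; apply: (@le_trans _ _ (u j x)); last first.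
      by rewrite leeDr// sume_ge0.
    by rewrite /u indicE mem_set//= mule1 -EFinM lee_fin mulrC ler_wpM2r.
rewrite integral_nneseries//.
have uE j : (\int[mu]_x u j x = (a j)%:E * \int[mu]_(x in C j.+1) (h x)%:E)%E.
  rewrite ge0_integralZl_EFin//; last by move=> x _; apply: mule_ge0; rewrite lee_fin.
  by rewrite (integral_mkcond (C j.+1)) epatch_indic.
apply: (@le_trans _ _ (\sum_(0 <= j <oo) (c2 * L ^+ 2 * T)%:E * (j.+1%:R * w (2 ^- j.-1))%:E)%E).
  apply: lee_nneseries => [j _ _|j _]; first by rewrite integral_ge0.
  rewrite uE; apply: (@le_trans _ _ ((a j)%:E * (T * j.+1%:R * m (C j.+1))%:E)%E).
    by rewrite lee_wpmul2l ?lee_fin.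
  rewrite -!EFinM lee_fin le_eqVlt; apply/orP; left; apply/eqP.
  by rewrite /a; field; exact: lt0r_neq0.
rewrite nneseriesZl; last by move=> j _; rewrite lee_fin mulr_ge0 ?ltW.
by rewrite [leRHS]EFinM lee_wpmul2l// lee_fin mulr_ge0.
Qed.

End KernelBound.

(** * Dyadic form of the Dini condition *)

Section DiniSum.
Context {R : realType}.
Variable w : R -> R.
Hypothesis mw : modulus_of_continuity w.

Local Notation dini t := (w t * ln t^-1 / t).

Let half_gt0 n : 0 < 2 ^- n :> R.
Proof. by rewrite invr_gt0 exprn_gt0. Qed.

Let half_le1 n : 2 ^- n <= 1 :> R.
Proof. by rewrite invf_le1 ?exprn_gt0// exprn_ege1// ler1n. Qed.

Let half_le n k : (n <= k)%N -> 2 ^- k <= 2 ^- n :> R.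
Proof. by move=> nk; rewrite lef_pV2 ?posrE ?exprn_gt0// ler_eXn2l// ltr1n. Qed.

Let w_ge0 t : 0 < t <= 1 -> 0 <= w t.
Proof. by have [h _ _] := mw => /h/andP[/ltW]. Qed.

Let dini_ge0 t : 0 < t <= 1 -> 0 <= dini t.
Proof.
move=> t01; have /andP[t0 t1] := t01.
rewrite divr_ge0 ?(ltW t0)// mulr_ge0 ?w_ge0// ln_ge0// invf_ge1//.
Qed.

Lemma omega_norm_ge1 : (1 <= omega_norm w)%E.
Proof.
by rewrite /omega_norm leeDl// integral_ge0.
Qed.

(** [w] is extended to a monotone, hence measurable, function on the line, and 1/t is written as
    exp(-ln t). *)
Lemma measurable_dini : measurable_fun (`]0, 1]%classic : set R) (fun t => dini t).
Proof.
pose v (t : R) := if t <= 0 then 0 else w (Num.min t 1).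
have mono : {homo v : x y / x <= y}.
  move=> x y xy; rewrite /v.
  have [h hm _] := mw; case: (leP x 0) => x0.
    case: (leP y 0) => // y0; apply: w_ge0.
    by rewrite lt_min y0 ltr01/= ge_min lexx orbT.
  rewrite (leNgt y) (lt_le_trans x0 xy)/=; apply: hm.
  - by rewrite lt_min x0 ltr01.
  - by rewrite le_min !ge_min xy lexx orbT.
  - by rewrite ge_min lexx orbT.
have mv : measurable_fun (`]0, 1]%classic : set R) v by exact: nondecreasing_measurable.
apply: (eq_measurable_fun (fun t => v t * - ln t * expR (- ln t))).
  move=> t; rewrite inE/= in_itv/= => /andP[t0 t1].
  rewrite -lnV ?posrE// lnK ?posrE ?invr_gt0// /v leNgt t0/=.
  by rewrite min_l.
have ml : measurable_fun (`]0, 1]%classic : set R) (fun t : R => - ln t).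
  by apply: measurable_funN; apply: measurable_funTS; exact: measurable_ln.
apply: measurable_funM; first exact: measurable_funM.
by apply: measurableT_comp => //; exact: measurable_expR.
Qed.

(** Between 2^-(i+2) and 2^-(i+1), an interval of length 2^-(i+2), the factors of the integrand are
    at least w(2^-(i+2)), (i+1) ln 2 and 2^(i+1). *)
Lemma dyadic_sum_le_integral :
  (\sum_(0 <= i <oo) (i.+1%:R * w (2 ^- i.+2) * (ln 2 / 2))%:E <=
   \int[lebesgue_measure]_(t in `]0%R, 1%R]) (dini t)%:E)%E.
Proof.
pose F i : set R := `]2 ^- i.+2, 2 ^- i.+1]%classic.
have F01 i : F i `<=` `]0, 1]%classic.
  move=> t; rewrite /F/= !in_itv/= => /andP[t1 t2].
  by rewrite (lt_trans (half_gt0 _) t1) (le_trans t2).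
have mF i : measurable (F i) by exact: measurable_itv.
have UF01 : \bigcup_i F i `<=` `]0, 1]%classic by move=> t [i _ /F01].
have mD := (measurable_EFinP _ _).2 measurable_dini.
have d0 t : `]0, 1]%classic t -> (0 <= (dini t)%:E)%E.
  by move=> /=; rewrite in_itv/= lee_fin; exact: dini_ge0.
have mU : measurable (\bigcup_i F i) by exact: bigcup_measurable.
apply: (@le_trans _ _ (\int[lebesgue_measure]_(t in \bigcup_i F i) (dini t)%:E)%E); last first.
  exact: ge0_subset_integral.
rewrite ge0_integral_bigcup//; last 3 first.
- exact: measurable_funS mD.
- by move=> t /UF01; exact: d0.
- apply/trivIsetP => i j _ _ ij.
  wlog ltij : i j ij / (i < j)%N.
    move=> h; move: (ij); rewrite neq_ltn => /orP[|ji]; first exact: h.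
    by rewrite setIC; apply: h => //; rewrite eq_sym.
  apply/seteqP; split => // t []; rewrite /F/= !in_itv/= => /andP[t1 _] /andP[_ t2].
  by have := lt_le_trans t1 t2; rewrite ltNge half_le.
apply: lee_nneseries => [i _ _|i _].
  by rewrite lee_fin mulr_ge0 ?divr_ge0 ?ln_ge0 ?ler1n// mulr_ge0// w_ge0// half_gt0/=.
pose c := w (2 ^- i.+2) * (ln 2 *+ i.+1) * 2 ^+ i.+1.
apply: (@le_trans _ _ (\int[lebesgue_measure]_(t in F i) c%:E)%E).
  have Fi : lebesgue_measure (F i) = (2 ^- i.+2)%:E.
    rewrite /F lebesgue_measure_itv/= lte_fin.
    rewrite ltf_pV2 ?posrE ?exprn_gt0// ltr_eXn2l ?ltr1n// ltnSn -EFinB.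
    by congr EFin; rewrite (exprS _ i.+1); field; rewrite expf_neq0.
  have -> : (\int[lebesgue_measure]_(t in F i) c%:E = c%:E * lebesgue_measure (F i))%E.
    by apply: integral_cst; exact: mF.
  rewrite Fi -EFinM lee_fin /c le_eqVlt; apply/orP; left; apply/eqP.
  rewrite (exprS _ i.+1) -mulr_natl; field.
  by rewrite expf_neq0.
apply: ge0_le_integral => //; first exact: mF.
- move=> t _; rewrite lee_fin /c mulr_ge0// mulr_ge0 ?w_ge0 ?half_gt0/=//.
  by rewrite mulrn_wge0// ln_ge0// ler1n.
- exact: measurable_funS mD.
- move=> t; rewrite /F/= in_itv/= => /andP[t1 t2]; rewrite lee_fin /c.
  have t0 : 0 < t := lt_trans (half_gt0 _) t1.
  have tle1 : t <= 1 := le_trans t2 (half_le1 _).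
  have l0 : 0 <= ln 2 *+ i.+1 :> R by rewrite mulrn_wge0// ln_ge0// ler1n.
  have w0 : 0 <= w (2 ^- i.+2) by rewrite w_ge0// half_gt0/=.
  have tV : 2 ^+ i.+1 <= t^-1 by rewrite -[leLHS]invrK lef_pV2 ?posrE.
  apply: ler_pM => //; first exact: mulr_ge0.
  apply: ler_pM => //.
  + by have [_ hm _] := mw; apply: hm => //; exact: ltW.
  + by rewrite -lnXn// ler_ln ?posrE ?invr_gt0 ?exprn_gt0.
Qed.

Lemma weighted_dyadic_sum_le :
  (\sum_(0 <= j <oo) (j.+1%:R * w (2 ^- j.-1))%:E <=
   (6 + 8 / ln 2)%:E * omega_norm w)%E.
Proof.
have wge0 n : 0 <= w (2 ^- n) by rewrite w_ge0// half_gt0/=.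
have wle1 n : w (2 ^- n) <= 1.
  by have [h _ _] := mw; have /h/andP[] : 0 < (2 ^- n : R) <= 1 by rewrite half_gt0/=.
have f0 j : (0 <= (j.+1%:R * w (2 ^- j.-1))%:E)%E by rewrite lee_fin mulr_ge0.
have ln20 : 0 < ln 2 :> R by rewrite ln_gt0// ltr1n.
(* The terms j = 0, 1, 2 add up to at most 1 + 2 + 3 = 6, as w <= 1. For j = i + 3 the factor i + 4
   is at most 4 (i + 1), whence the constant 8 / ln 2. *)
rewrite (nneseries_split _ 3)// add0n.
rewrite -nneseries_addn//.
set I := (\int[lebesgue_measure]_(t in `]0%R, 1%R]) (dini t)%:E)%E.
have I0 : (0 <= I)%E.
  apply: integral_ge0 => t /=; rewrite in_itv/= lee_fin; exact: dini_ge0.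
apply: (@le_trans _ _ (6%:E + (8 / ln 2)%:E * I)%E).
  apply: leeD.
    rewrite !big_nat_recl//= big_geq// adde0 -!EFinD lee_fin.
    by have := wle1 0%N; have := wle1 1%N; lra.
  apply: (@le_trans _ _ (\sum_(0 <= i <oo) (8 / ln 2)%:E *
      (i.+1%:R * w (2 ^- i.+2) * (ln 2 / 2))%:E)%E).
    apply: lee_nneseries => // i _; rewrite -EFinM lee_fin addn3/=.
    rewrite [leRHS](_ : _ = 4 * i.+1%:R * w (2 ^- i.+2)); last first.
      by field; exact: lt0r_neq0.
    by rewrite ler_wpM2r// -natrM ler_nat mulnS -[i.+4]/(4 + i)%N leq_add2l leq_pmull.
  rewrite nneseriesZl; last first.
    by move=> i _; rewrite lee_fin; apply: mulr_ge0; [exact: mulr_ge0|rewrite divr_ge0// ltW].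
  apply: lee_wpmul2l; first by rewrite lee_fin divr_ge0// ltW.
  exact: dyadic_sum_le_integral.
rewrite /omega_norm -/I (ge0_muleDr _ _ I0)//; apply: leeD.
  by rewrite -EFinM mulr1 lee_fin lerDl divr_ge0// ltW.
by rewrite lee_wpmul2r// lee_fin lerDr.
Qed.

End DiniSum.

(** * Covering by disjoint balls *)

Section Covering.
Context {d : measure_display} {X : measurableType d} {R : realType}.
Variables (mu : {measure set X -> \bar R}) (Balls : set (set X)) (K : R).
Hypothesis bb : ball_basis mu Balls K.
Implicit Types (V P Q : set X) (F : set (set X)).

Local Notation m A := (fine (mu A)).

(** Among the members of [F] disjoint from [W], [P] has measure above half the supremum; the empty
    set signals that none is left. *)
Let greedy_choice F V W : F `<=` Balls -> (forall Q, F Q -> Q `<=` V) ->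
  measurable V -> (mu V < +oo)%E ->
  exists P, [/\ F P, P `&` W = set0 &
      forall Q, F Q -> Q `&` W = set0 -> m Q <= 2 * m P] \/
    P = set0 /\ forall Q, F Q -> Q `&` W !=set0.
Proof.
move=> FB FV mV Voo.
have [[Q0 [FQ0 Q0W]]|h] := pselect (exists Q, F Q /\ Q `&` W = set0); last first.
  exists set0; right; split => // Q FQ; apply/set0P/eqP => QW.
  by apply: h; exists Q.
pose S := [set m Q | Q in [set Q | F Q /\ Q `&` W = set0]].
have supS : has_sup S.
  split; first by exists (m Q0); exists Q0.
  exists (m V) => _ [Q [FQ _] <-].
  rewrite -lee_fin -(ballE bb (FB _ FQ)) fineK ?ge0_fin_numE//.
  apply: le_measure; rewrite ?inE//; first exact: (ball_measurable bb (FB _ FQ)).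
  exact: FV.
have ubS := sup_upper_bound supS.
have s0 : 0 < sup S.
  apply: lt_le_trans (ball_gt0 bb (FB _ FQ0)) _.
  by apply: ubS; exists Q0.
have s2 : 0 < sup S / 2 by rewrite divr_gt0.
have [_ [P [FP PW] <-] sP] := sup_adherent s2 supS.
exists P; left; split => // Q FQ QW.
have : m Q <= sup S by apply: ubS; exists Q.
lra.
Qed.

(** Greedy Vitali selection: each new ball avoids the union W_n of the earlier ones. If Q misses W_k
    but meets W_(k+1), it competed with P_k and meets it, so mu(Q) <= 2 mu(P_k) and Q lies in
    P_k^*. *)
Lemma disjoint_subfamily F V : F `<=` Balls -> (forall Q, F Q -> Q `<=` V) ->
  measurable V -> (mu V < +oo)%E ->
  exists P : nat -> set X,
  [/\ forall n, F (P n) \/ P n = set0, trivIset setT P &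
      forall Q, F Q -> exists n, F (P n) /\ Q `<=` star mu Balls (P n)].
Proof.
move=> FB FV mV Voo.
have /choice[next nextP] : forall W, exists P, _ :=
  fun W => greedy_choice W FB FV mV Voo.
pose W n := iter n (fun W => W `|` next W) set0.
pose P n := next (W n).
have PW n : P n `&` W n = set0.
  by rewrite /P; case: (nextP (W n)) => [[]//|[-> _]]; rewrite set0I.
have FP n : F (P n) \/ P n = set0.
  by rewrite /P; case: (nextP (W n)) => [[]|[]]; [left|right].
have mP n : measurable (P n).
  by case: (FP n) => [/FB/(ball_measurable bb)//|->].
have PV n : P n `<=` V by case: (FP n) => [/FV//|->].
have PsubW i j : (i < j)%N -> P i `<=` W j.
  elim: j => // j ih; rewrite ltnS leq_eqVlt => /predU1P[-> x Px|/ih h x /h].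
    by right.
  by left.
have tP : trivIset setT P.
  apply/trivIsetP => i j _ _ ij.
  wlog ltij : i j ij / (i < j)%N.
    move=> h; move: (ij); rewrite neq_ltn => /orP[|ji]; first exact: h.
    by rewrite setIC; apply: h => //; rewrite eq_sym.
  apply/seteqP; split => // x [Pix Pjx]; rewrite -(PW j).
  by split => //; exact: PsubW Pix.
exists P; split => // Q FQ.
have mQ := ball_gt0 bb (FB _ FQ).
(* If Q never met the selected balls, infinitely many disjoint subsets of V would have measure at
   least mu(Q)/2, against the finiteness of mu(V). *)
have [n Qn] : exists n, Q `&` W n !=set0.
  apply: contrapT => /forallNP h.
  have QW n : Q `&` W n = set0 by apply/nonemptyPn; exact: h.
  have Pbig n : F (P n) /\ m Q <= 2 * m (P n).
    rewrite /P; case: (nextP (W n)) => [[? ? /(_ Q FQ (QW n))]//|[_ /(_ _ FQ)]].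
    by rewrite QW => -[].
  have : (\sum_(0 <= n <oo) mu (P n) <= mu V)%E.
    rewrite [leLHS](_ : _ = mu (\bigcup_n P n)); last first.
      by rewrite measure_bigcup//; apply: eq_eseriesl => i; rewrite in_setT.
    apply: le_measure; rewrite ?inE//; first exact: bigcup_measurable.
    by move=> x [n _ /PV].
  pose N := Num.bound (2 * m V / m Q).
  have hN : 2 * m V / m Q < N%:R by rewrite archi_boundP// divr_ge0 ?mulr_ge0 ?ltW.
  move=> /(le_trans (nneseries_lim_ge N (fun _ _ _ => measure_ge0 _ _))).
  apply/negP; rewrite -ltNge -[mu V]fineK ?ge0_fin_numE//.
  apply: (@lt_le_trans _ _ (\sum_(0 <= i < N) (m Q / 2)%:E)%E).
    rewrite sumEFin lte_fin sumr_const_nat subn0 -mulr_natl.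
    by move: hN; rewrite ltr_pdivrMr//; lra.
  apply: lee_sum => i _; have [FPi hi] := Pbig i.
  suff : ((m Q / 2)%:E <= mu (P i))%E by [].
  by rewrite (ballE bb (FB _ FPi)) lee_fin; lra.
have [k [Qk QSk]] : exists k, Q `&` W k = set0 /\ Q `&` W k.+1 !=set0.
  elim: n Qn => [[x []//]|n ih QSn].
  by have [/ih//|/nonemptyPn Qn0] := pselect (Q `&` W n !=set0); exists n.
have QPk : Q `&` P k !=set0.
  have [x [Qx [Wx|Px]]] := QSk; last by exists x.
  suff : set0 x by [].
  by rewrite -Qk.
exists k; rewrite /P; case: (nextP (W k)) => [[FPk _ /(_ _ FQ Qk) le2]|[_ /(_ _ FQ)]].
  by split => //; apply: (sub_star bb) => //; exact: FB.
by rewrite Qk => -[].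
Qed.

(** A weak-type estimate: the hulls of the disjoint selected balls cover the union at the cost of
    [K], and disjointness bounds the sum of their integrals by the integral over V. *)
Lemma measure_bigcup_balls_le F V (g : X -> \bar R) (t : R) :
  F `<=` Balls -> (forall Q, F Q -> Q `<=` V) ->
  measurable V -> (mu V < +oo)%E ->
  measurable_fun V g -> (forall x, V x -> (0 <= g x)%E) -> 0 < t -> 0 <= K ->
  (forall Q, F Q -> ((t * m Q)%:E <= \int[mu]_(x in Q) g x)%E) ->
  (t%:E * mu (\bigcup_(Q in F) Q) <= K%:E * \int[mu]_(x in V) g x)%E.
Proof.
move=> FB FV mV Voo mg g0 t0 K0 Fg.
have [P [FP tP QP]] := disjoint_subfamily FB FV mV Voo.
have mP n : measurable (P n).
  by case: (FP n) => [/FB/(ball_measurable bb)//|->].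
have PV n : P n `<=` V by case: (FP n) => [/FV//|->].
have /choice[H HP] : forall n, exists H : set X, [/\ measurable H,
    F (P n) -> star mu Balls (P n) `<=` H &
    (mu H <= K%:E * mu (P n))%E].
  move=> n; have [FPn|FPn] := pselect (F (P n)).
    have [H BH [sH HK]] := ball_hull bb (FB _ FPn).
    exists H; split => //; first exact: (ball_measurable bb BH).
    by rewrite (ballE bb BH) (ballE bb (FB _ FPn)) -EFinM lee_fin.
  exists set0; split => //.
  by rewrite measure0 mule_ge0.
have [_ _ _ _ sep] := bb.
have t0' : (0 <= t%:E)%E by rewrite lee_fin ltW.
apply: (@le_trans _ _ (t%:E * \sum_(0 <= n <oo) mu (H n))%E).
  rewrite lee_wpmul2l//; apply: measure_sigma_subadditive => [n||].
  - by have [] := HP n.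
  - exact: sep.
  - move=> x [Q FQ Qx]; have [n [FPn Qs]] := QP _ FQ.
    by exists n => //; have [_ h _] := HP n; apply: h => //; exact: Qs.
rewrite -nneseriesZl; last by move=> n _; exact: measure_ge0.
apply: (@le_trans _ _ (\sum_(0 <= n <oo) K%:E * \int[mu]_(x in P n) g x)%E).
  apply: lee_nneseries => [n _ _|n _]; first by rewrite mule_ge0.
  have [_ _ HK] := HP n.
  apply: (@le_trans _ _ (t%:E * (K%:E * mu (P n)))%E); first by rewrite lee_wpmul2l.
  rewrite muleCA lee_wpmul2l ?lee_fin//.
  case: (FP n) => [FPn|->]; last by rewrite measure0 mule0 integral_set0.
  by rewrite (ballE bb (FB _ FPn)) -EFinM Fg.
rewrite nneseriesZl; last first.
  by move=> n _; apply: integral_ge0 => x /PV; exact: g0.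
rewrite lee_wpmul2l ?lee_fin// -ge0_integral_bigcup//.
- apply: ge0_subset_integral => //; first exact: bigcup_measurable.
  by move=> x [n _ /PV].
- apply: measurable_funS mg => //.
  by move=> x [n _ /PV].
- by move=> x [n _ /PV]; exact: g0.
Qed.

End Covering.

(** * Mean oscillation over balls *)

(* Replaces Hoelder's inequality: integrated over a ball whose mean r-th power
   of g is at most a^r, it bounds the mean of g by 2 a. *)
Lemma le_powR_scale {R : realType} (r a t : R) : 1 <= r -> 0 < a -> 0 <= t ->
  t <= a + a * (t / a) `^ r.
Proof.
move=> r1 a0 t0; have [ta|/ltW at_] := leP t a.
  by rewrite (le_trans ta)// lerDl mulr_ge0 ?powR_ge0// ltW.
have ta1 : 1 <= t / a by rewrite ler_pdivlMr// mul1r.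
have : t / a <= (t / a) `^ r by rewrite -[leLHS]powRr1 ?ler_powR// divr_ge0// ltW.
by rewrite ler_pdivrMr// mulrC => h; rewrite (le_trans h)// lerDr ltW.
Qed.

Section Oscillation.
Context {d : measure_display} {X : measurableType d} {R : realType}
  {U : completeNormedModType R}.
Variables (mu : {measure set X -> \bar R}) (Balls : set (set X)) (K : R).
Hypothesis bb : ball_basis mu Balls K.
Variables (r : R) (f : X -> U).
Hypothesis r1 : 1 <= r.
Hypothesis Lrf : bochner_Lr mu r f.
Implicit Types (A B D : set X) (c : U).

Local Notation m A := (fine (mu A)).
Local Notation avg A := (average mu A f).

Let r0 : 0 < r.
Proof. exact: lt_le_trans ltr01 r1. Qed.

Let smf : strongly_measurable f.
Proof. by have [] := Lrf. Qed.

Let measurable_dist c A : measurable_fun A (fun x => (`|f x - c|)%:E).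
Proof. by apply/measurable_EFinP; exact: strongly_measurable_norm_sub_cst. Qed.

Lemma measurable_dist_pow c (a : R) A :
  measurable_fun A (fun x => ((`|f x - c| / a) `^ r)%:E).
Proof.
apply/measurable_EFinP; apply: (measurableT_comp (measurable_powR r)).
apply: measurable_funM; last exact: measurable_cst.
exact: strongly_measurable_norm_sub_cst.
Qed.

Lemma integral_dist_le c (a : R) A : Balls A -> 0 < a ->
  (\int[mu]_(x in A) (`|f x - c|)%:E <=
   (a * m A)%:E + a%:E * \int[mu]_(x in A) ((`|f x - c| / a) `^ r)%:E)%E.
Proof.
move=> BA a0; have mA := ball_measurable bb BA.
have mp : measurable_fun A (fun x => ((`|f x - c| / a) `^ r)%:E).
  exact: measurable_dist_pow.
have p0 x : A x -> (0 <= ((`|f x - c| / a) `^ r)%:E)%E.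
  by move=> _; rewrite lee_fin powR_ge0.
rewrite EFinM -(ballE bb BA) -integral_cst// -ge0_integralZl_EFin ?(ltW a0)//.
have map : measurable_fun A (fun x => a%:E * ((`|f x - c| / a) `^ r)%:E)%E.
  exact: measurable_funeM.
rewrite -ge0_integralD//.
- apply: ge0_le_integral => //.
  + by apply: emeasurable_funD => //; exact: measurable_cst.
  + by move=> x _; rewrite -EFinM -EFinD lee_fin le_powR_scale.
- by move=> x _; rewrite lee_fin ltW.
- by move=> x Ax; rewrite mule_ge0 ?p0// lee_fin ltW.
Qed.

Lemma integral_norm_le A : Balls A ->
  (\int[mu]_(x in A) (`|f x|)%:E <=
   (m A)%:E + \int[mu]_x (`|f x| `^ r)%:E)%E.
Proof.
move=> BA; have := integral_dist_le 0 BA ltr01.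
under eq_integral do rewrite subr0.
move=> /le_trans; apply; rewrite mul1r mul1e leeD2l//.
under eq_integral do rewrite subr0 divr1.
have mfr : measurable_fun setT (fun x => (`|f x| `^ r)%:E).
  have : measurable_fun setT (fun x => ((`|f x - 0| / 1) `^ r)%:E).
    exact: measurable_dist_pow.
  by under eq_fun do rewrite subr0 divr1.
by apply: ge0_subset_integral => //; exact: (ball_measurable bb BA).
Qed.

Lemma average_dist_le A c : Balls A ->
  ((m A * `|avg A - c|)%:E <= \int[mu]_(x in A) (`|f x - c|)%:E)%E.
Proof.
move=> BA; apply: average_sub_le => //.
- exact: (ball_measurable bb BA).
- exact: (ball_lty bb BA).
- apply: le_lt_trans (integral_norm_le BA) _.
  by rewrite lte_add_pinfty ?ltry//; have [] := Lrf.
Qed.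

(** The bound is uniform over balls containing a fixed one, which later gives finiteness of the
    maximal function. *)
Lemma average_norm_le A : Balls A ->
  `|avg A| <= 1 + fine (\int[mu]_x (`|f x| `^ r)%:E)%E / m A.
Proof.
move=> BA; have mA := ball_gt0 bb BA.
have := average_dist_le 0 BA; rewrite subr0.
under eq_integral do rewrite subr0.
move=> /le_trans/(_ (integral_norm_le BA)).
have Ifin : (\int[mu]_x (`|f x| `^ r)%:E)%E \is a fin_num.
  rewrite ge0_fin_numE; first by have [] := Lrf.
  by apply: integral_ge0 => x _; rewrite lee_fin powR_ge0.
rewrite -{1}(fineK Ifin) -EFinD lee_fin -ler_pdivlMl// => /le_trans; apply.
by rewrite mulrDr mulVf ?gt_eqF// mulrC.
Qed.

Lemma dist_le_split A c (T1 : R) c' : Balls A ->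
  (\int[mu]_(x in A) (`|f x - c'|)%:E <= (T1 * m A)%:E)%E ->
  (\int[mu]_(x in A) (`|f x - c|)%:E <= ((T1 + `|c' - c|) * m A)%:E)%E.
Proof.
move=> BA hT; have mA := ball_measurable bb BA.
apply: (@le_trans _ _ (\int[mu]_(x in A) ((`|f x - c'|)%:E + (`|c' - c|)%:E))%E).
  apply: ge0_le_integral => //; first exact: emeasurable_funD.
  by move=> x _; rewrite -EFinD lee_fin ler_distD.
rewrite ge0_integralD// integral_cst// (ballE bb BA) -EFinM.
by rewrite mulrDl EFinD leeD2r.
Qed.

(** * Consequences of a bound on the sharp function *)

Section BoundedOscillation.
Variables (B : set X) (s : R).
Hypothesis BB : Balls B.
Hypothesis s0 : 0 < s.
Hypothesis osc_le : forall A, Balls A -> B `<=` A ->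
  (mean_osc mu r f A <= s%:E)%E.

(** The level [a = s] yields the bound on the mean deviation, and [a = lam] the estimate of the
    exceptional set. *)
Lemma integral_osc_pow_le A (a : R) : Balls A -> B `<=` A -> 0 < a ->
  (\int[mu]_(x in A) ((`|f x - avg A| / a) `^ r)%:E <=
   ((s / a) `^ r * m A)%:E)%E.
Proof.
move=> BA BA' a0; have mA := ball_gt0 bb BA.
have := osc_le BA BA'; rewrite /mean_osc.
set I := (\int[mu]_(x in A) _)%E.
have I0 : (0 <= I)%E by apply: integral_ge0 => x _; rewrite lee_fin powR_ge0.
set J := (_ * I)%E; have J0 : (0 <= J)%E by rewrite mule_ge0// lee_fin invr_ge0 ltW.
move=> /(gt0_ler_poweR (ltW r0)).
rewrite !in_itv/= !leey poweR_ge0 lee_fin (ltW s0) => /(_ isT isT).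
rewrite -poweRrM mulVf ?gt_eqF// poweRe1// => JI.
have IE : I = ((m A)%:E * J)%E.
  by rewrite /J muleA -EFinM divff ?gt_eqF// mul1e.
have -> : (\int[mu]_(x in A) ((`|f x - avg A| / a) `^ r)%:E =
    (a^-1 `^ r)%:E * I)%E.
  rewrite -ge0_integralZl_EFin ?powR_ge0//; first last.
  - have : measurable_fun A (fun x => ((`|f x - avg A| / 1) `^ r)%:E).
      exact: measurable_dist_pow.
    by under eq_fun do rewrite divr1.
  - exact: (ball_measurable bb BA).
  by apply: eq_integral => x _; rewrite powRM// ?invr_ge0 ?(ltW a0)// mulrC EFinM.
rewrite IE powRM ?(ltW s0) ?invr_ge0 ?(ltW a0)// (mulrC (s `^ r)) -mulrA EFinM.
rewrite lee_wpmul2l ?lee_fin ?powR_ge0// mulrC EFinM.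
by rewrite lee_wpmul2l// lee_fin ltW.
Qed.

Lemma integral_osc_le A : Balls A -> B `<=` A ->
  (\int[mu]_(x in A) (`|f x - avg A|)%:E <= (2 * s * m A)%:E)%E.
Proof.
move=> BA BA'; apply: (le_trans (integral_dist_le (avg A) BA s0)).
have := integral_osc_pow_le BA BA' s0; rewrite divff ?gt_eqF// powR1 mul1r => h.
apply: (@le_trans _ _ ((s * m A)%:E + s%:E * (m A)%:E)%E).
  by rewrite leeD2l// lee_wpmul2l// lee_fin ltW.
by rewrite -EFinM -EFinD lee_fin; lra.
Qed.

(** The integral of |f - avg A| over D is at most that over A, and dividing by mu(D) costs the ratio
    [k]. *)
Lemma average_sub_average_le D A (k : R) : Balls D -> Balls A -> B `<=` A ->
  D `<=` A -> m A <= k * m D -> `|avg D - avg A| <= 2 * s * k.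
Proof.
move=> BD BA BA' DA mk; have mD := ball_gt0 bb BD.
rewrite -(ler_pM2l mD) -lee_fin; apply: (le_trans (average_dist_le _ BD)).
apply: (@le_trans _ _ (2 * s * m A)%:E); last first.
  by rewrite lee_fin mulrCA ler_pM2l ?mulr_gt0// mulrC.
apply: le_trans (integral_osc_le BA BA').
by apply: ge0_subset_integral => //; exact: (ball_measurable bb).
Qed.

Lemma integral_dist_avg_le A c : Balls A -> B `<=` A ->
  (\int[mu]_(x in A) (`|f x - c|)%:E <=
   ((2 * s + `|avg A - c|) * m A)%:E)%E.
Proof. by move=> BA BA'; apply: dist_le_split => //; exact: integral_osc_le. Qed.

End BoundedOscillation.
End Oscillation.

(** * Oscillation of the maximal function *)

Section MaximalOscillation.
Context {d : measure_display} {X : measurableType d} {R : realType}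
  {U : completeNormedModType R}.
Variables (mu : {measure set X -> \bar R}) (Balls : set (set X)) (K eta : R).
Hypothesis bb : ball_basis mu Balls K.
Hypothesis eta1 : 1 < eta.
Hypothesis dbl : doubling mu Balls eta.
Variables (w : R -> R) (c2 : R) (phi : set X -> X -> R) (W : R).
Hypothesis mw : modulus_of_continuity w.
Hypothesis reg : omega_regular mu Balls w c2 phi.
Hypothesis sumW : (\sum_(0 <= j <oo) (j.+1%:R * w (2 ^- j.-1))%:E <= W%:E)%E.
Variables (r : R) (f : X -> U).
Hypothesis r1 : 1 <= r.
Hypothesis Lrf : bochner_Lr mu r f.
Implicit Types (A B D : set X) (c : U).

Local Notation m A := (fine (mu A)).
Local Notation L := (chain_constant K eta).
Local Notation avg A := (average mu A f).
Local Notation phi_mean A := (\int[mu]_y (`|f y| * phi A y)%:E)%E.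

Let L1 : 1 <= L := chain_constant_ge1 K eta1.

Let measurable_dist c A : measurable_fun A (fun x => `|f x - c|).
Proof. by apply: strongly_measurable_norm_sub_cst; have [] := Lrf. Qed.

Let measurable_phi A : Balls A -> measurable_fun setT (phi A).
Proof.
have [h _ _ _] := reg.
by move=> /h[_ /integrableP[/measurable_EFinP]].
Qed.

Let phi_ge0 A x : Balls A -> 0 <= phi A x.
Proof. by have [h _ _ _] := reg => /h[]. Qed.

Let integral_phi A : Balls A -> (\int[mu]_x (phi A x)%:E = 1)%E.
Proof.
move=> BA; have [h _ _ _] := reg; have [_ _ <-] := h _ BA.
by apply: eq_integral => x _; rewrite ger0_norm// phi_ge0.
Qed.

Let integral_cst_phi A (a : R) : Balls A -> 0 <= a ->
  (\int[mu]_x (a * phi A x)%:E = a%:E)%E.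
Proof.
move=> BA a0; under eq_integral do rewrite EFinM.
rewrite ge0_integralZl_EFin//; first by rewrite integral_phi// mule1.
- by move=> x _; rewrite lee_fin phi_ge0.
- by apply/measurable_EFinP; exact: measurable_phi.
Qed.

(** phi_A is a probability density, so both bounds are the triangle inequality averaged against
    it. *)
Lemma phi_mean_near A c (T : R) : Balls A ->
  (\int[mu]_x (`|f x - c| * phi A x)%:E <= T%:E)%E ->
  (phi_mean A <= (`|c| + T)%:E)%E /\ (`|c|%:E <= phi_mean A + T%:E)%E.
Proof.
move=> BA hT; have mp := measurable_phi BA.
have mdist c' : measurable_fun setT (fun x => (`|f x - c'| * phi A x)%:E).
  by apply/measurable_EFinP; exact: measurable_funM.
have mnorm : measurable_fun setT (fun x => (`|f x| * phi A x)%:E).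
  by have := mdist 0; under eq_fun do rewrite subr0.
have mcst : measurable_fun setT (fun x => (`|c| * phi A x)%:E).
  by apply/measurable_EFinP; exact: measurable_funM.
have pos (a : R) x : 0 <= a -> (0 <= (a * phi A x)%:E)%E.
  by move=> a0; rewrite lee_fin mulr_ge0// phi_ge0.
split.
- apply: (@le_trans _ _ (\int[mu]_x ((`|c| * phi A x)%:E + (`|f x - c| * phi A x)%:E))%E).
    apply: ge0_le_integral => //.
    + by move=> x _; exact: pos.
    + exact: emeasurable_funD.
    + move=> x _; rewrite -EFinD lee_fin -mulrDl ler_wpM2r ?phi_ge0//.
      by have := ler_distD c (f x) 0; rewrite !subr0; lra.
  rewrite ge0_integralD//; [|by move=> x _; exact: pos..].
  by rewrite integral_cst_phi// EFinD leeD2l.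
- rewrite -(integral_cst_phi BA (normr_ge0 c)).
  apply: (@le_trans _ _ (\int[mu]_x ((`|f x| * phi A x)%:E + (`|f x - c| * phi A x)%:E))%E).
    apply: ge0_le_integral => //.
    + by move=> x _; exact: pos.
    + exact: emeasurable_funD.
    + move=> x _; rewrite -EFinD lee_fin -mulrDl ler_wpM2r ?phi_ge0//.
      by have := ler_distD (f x) c 0; rewrite !subr0 (distrC c); lra.
  rewrite ge0_integralD//; [|by move=> x _; exact: pos..].
  by rewrite leeD2l.
Qed.

(** * Means over balls that are large compared with [B] *)

Variables (B : set X) (s lam : R).
Hypothesis BB : Balls B.
Hypothesis s0 : 0 < s.
Hypothesis lam0 : 0 < lam.
Hypothesis osc_le : forall A, Balls A -> B `<=` A ->
  (mean_osc mu r f A <= s%:E)%E.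

Let avg_step D A k : Balls D -> Balls A -> B `<=` A -> D `<=` A ->
  m A <= k * m D -> `|avg D - avg A| <= 2 * s * k.
Proof. exact: (average_sub_average_le bb r1 Lrf s0 osc_le). Qed.

Let W_ge0 : 0 <= W.
Proof.
rewrite -lee_fin; apply: le_trans sumW; apply: nneseries_ge0 => j _ _.
have [h _ _] := mw; rewrite lee_fin mulr_ge0//.
have /h/andP[/ltW//] : 0 < (2 ^- j.-1 : R) <= 1.
by rewrite invr_gt0 exprn_gt0//= invf_le1 ?exprn_gt0// exprn_ege1// ler1n.
Qed.

(** Each chain step moves the average by at most 2 s L, so the mean deviation on C_(j+1) from the
    average over C_1 is at most 2 s L (j + 1), the growth that [kernel_integral_le] allows. *)
Lemma integral_dist_phi_large A (C : nat -> set X) :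
  ball_chain mu Balls K eta A C -> B `<=` C 1%N ->
  (\int[mu]_x (`|f x - avg (C 1%N)| * phi A x)%:E <=
   (c2 * L ^+ 2 * (2 * s * L) * W)%:E)%E.
Proof.
move=> chainC BC1; have BC := chain_ball chainC.
have BC' j : B `<=` C j.+1.
  exact: subset_trans BC1 (@chain_sub _ _ _ _ _ _ _ bb _ _ chainC 1%N j.+1 _).
have sL : 0 <= 2 * s * L by rewrite !mulr_ge0 ?(ltW s0)// (le_trans ler01).
apply: (kernel_integral_le bb eta1 mw reg chainC) => // j.
have near : `|avg (C j.+1) - avg (C 1%N)| <= 2 * s * L * j%:R.
  elim: j => [|j ih]; first by rewrite subrr normr0 mulr0.
  have := avg_step (BC j.+1) (BC j.+2) (BC' j.+1)
    (@chainS _ _ _ _ _ _ _ bb _ _ chainC j.+1) (chain_le chainC j.+1).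
  have := ler_distD (avg (C j.+1)) (avg (C j.+2)) (avg (C 1%N)).
  by rewrite (distrC (avg (C j.+2)) (avg (C j.+1))) -[j.+1%:R]natr1; lra.
apply: (le_trans (integral_dist_avg_le bb r1 Lrf s0 osc_le _ (BC j.+1) (BC' j))).
rewrite lee_fin ler_pM2r ?(ball_gt0 bb)// -[j.+1%:R]natr1 mulrDr mulr1 addrC.
by rewrite lerD// ler_peMr// mulr_ge0// ltW.
Qed.

(** * Small balls and the exceptional set *)

Variable D : nat -> set X.
Hypothesis chainD : ball_chain mu Balls K eta B D.

Let BD := chain_ball chainD.
Let BD1 : B `<=` D 1%N := @chain_sub0 _ _ _ _ _ _ _ bb _ _ chainD 1%N.

Let avg_B_D1 : `|avg B - avg (D 1%N)| <= 2 * s * L.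
Proof.
apply: avg_step => //; have [D0 _ _ _ _] := chainD.
by have := chain_le chainD 0; rewrite D0.
Qed.

(** The factor 2 is chosen so that [integral_dist_le] at level [lam], which uses up one [lam * m Q],
    leaves an r-th power integral above mu(Q). *)
Definition exceptional : set (set X) :=
  [set Q | [/\ Balls Q, Q `<=` D 1%N &
    ((2 * lam * m Q)%:E < \int[mu]_(x in Q) (`|f x - avg (D 1%N)|)%:E)%E]].

(** In units of 2 s: once C_j outgrows B, the average over C_(j+1) is compared with that over B at
    cost L^2, and B with D_1 at cost L; every later step costs another L. *)
Lemma average_near_small A (C : nat -> set X) j :
  ball_chain mu Balls K eta A C -> m A <= m B -> A `&` B !=set0 ->
  m B < m (C j) ->
  B `<=` C j.+1 /\
  `|avg (C j.+1) - avg (D 1%N)| <= 2 * s * (L ^+ 2 + L + L * j%:R).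
Proof.
move=> chainC AB [z [Az Bz]]; have BC := chain_ball chainC.
have Cz k : C k z by exact: (@chain_sub0 _ _ _ _ _ _ _ bb _ _ chainC).
have BsubC k : m B < m (C k) -> B `<=` C k.+1.
  move=> BCk; apply: subset_trans (@chain_star _ _ _ _ _ _ _ _ _ chainC k).
  apply: (sub_star bb) => //; last by exists z.
  by have := ball_gt0 bb (BC k); lra.
elim: j => [|j ih] BCj.
  by move: BCj; have [-> _ _ _ _] := chainC; rewrite ltNge AB.
split; first exact: BsubC.
have [CjB|BCj'] := leP (m (C j)) (m B).
  have h : `|avg B - avg (C j.+2)| <= 2 * s * L ^+ 2.
    apply: avg_step => //; [exact: BsubC|exact: BsubC|].
    apply: (le_trans (chain_le chainC _)).
    rewrite expr2 -mulrA ler_wpM2l ?(le_trans ler01 L1)//.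
    by apply: (le_trans (chain_le chainC _)); rewrite ler_wpM2l ?(le_trans ler01 L1).
  have := ler_distD (avg B) (avg (C j.+2)) (avg (D 1%N)).
  rewrite (distrC (avg (C j.+2)) (avg B)); have := avg_B_D1.
  have : 0 <= 2 * s * (L * j.+1%:R).
    by rewrite !mulr_ge0 ?(ltW s0)// (le_trans ler01).
  by rewrite !mulrDr; lra.
have [_ near] := ih BCj'.
have := avg_step (BC j.+1) (BC j.+2) (BsubC _ BCj)
    (@chainS _ _ _ _ _ _ _ bb _ _ chainC j.+1) (chain_le chainC j.+1).
have := ler_distD (avg (C j.+1)) (avg (C j.+2)) (avg (D 1%N)).
rewrite (distrC (avg (C j.+2)) (avg (C j.+1))) -[j.+1%:R]natr1.
by move: near; rewrite !mulrDr mulr1; lra.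
Qed.

(** A chain ball no larger than B lies in D_1 and contains x, so it is not exceptional. A larger
    C_(j+1) is enlarged to C_(j+2), which contains B and is handled by [average_near_small]. *)
Lemma integral_dist_phi_small A (C : nat -> set X) x :
  ball_chain mu Balls K eta A C -> m A <= m B -> A x -> B x ->
  ~ (\bigcup_(Q in exceptional) Q) x ->
  (\int[mu]_y (`|f y - avg (D 1%N)| * phi A y)%:E <=
   (c2 * L ^+ 2 * (2 * lam + 8 * L ^+ 3 * s) * W)%:E)%E.
Proof.
move=> chainC AB Ax Bx xE; have BC := chain_ball chainC.
have Cx k : C k x by exact: (@chain_sub0 _ _ _ _ _ _ _ bb _ _ chainC).
have L3 : 0 <= 8 * L ^+ 3 * s.
  apply: mulr_ge0 (ltW s0); apply: mulr_ge0 => //.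
  exact: exprn_ge0 (le_trans ler01 L1).
apply: (kernel_integral_le bb eta1 mw reg chainC) => //; last first.
  by rewrite addr_ge0// mulr_ge0// ltW.
move=> j; have mC := ball_gt0 bb (BC j.+1).
have j1 : 1 <= j.+1%:R :> R by rewrite ler1n.
have [CB|BC1] := leP (m (C j.+1)) (m B).
  apply: (@le_trans _ _ (2 * lam * m (C j.+1))%:E).
    rewrite leNgt; apply/negP => h; apply: xE; exists (C j.+1) => //; split => //.
    apply: subset_trans (_ : star mu Balls (D 0%N) `<=` _).
      have [-> _ _ _ _] := chainD; apply: (sub_star bb) => //; last by exists x.
      by have := ball_gt0 bb BB; lra.
    exact: (@chain_star _ _ _ _ _ _ _ _ _ chainD 0%N).
  rewrite lee_fin ler_pM2r//; apply: (@le_trans _ _ (2 * lam + 8 * L ^+ 3 * s)).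
    by rewrite lerDl.
  by rewrite ler_peMr// addr_ge0// mulr_ge0// ltW.
have [BC2 near] := average_near_small chainC AB (ex_intro _ x (conj Ax Bx)) BC1.
apply: (@le_trans _ _ (\int[mu]_(y in C j.+2) (`|f y - avg (D 1%N)|)%:E)%E).
  apply: ge0_subset_integral => //; try exact: (ball_measurable bb).
  - by apply/measurable_EFinP.
  - exact: (@chainS _ _ _ _ _ _ _ bb _ _ chainC j.+1).
apply: (le_trans (integral_dist_avg_le bb r1 Lrf s0 osc_le _ (BC j.+2) BC2)).
have mC2 := chain_le chainC j.+1; have mC2' := ball_gt0 bb (BC j.+2).
rewrite lee_fin.
set n := j.+1%:R in j1 near *.
(* 1 + L^2 + L + L n is at most 4 L^2 n; with the factor 2 s and the L lost in enlarging the ball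
   this makes 8 L^3 s n. *)
apply: (@le_trans _ _ ((2 * s * (4 * L ^+ 2 * n)) * (L * m (C j.+1)))).
  have L0 : 0 <= L := le_trans ler01 L1.
  have L12 : L <= L ^+ 2 by rewrite expr2 ler_peMr.
  have L2n : L ^+ 2 <= L ^+ 2 * n by rewrite ler_peMr ?exprn_ge0.
  have L12n : L * n <= L ^+ 2 * n by rewrite ler_wpM2r// (le_trans ler01).
  have b0 : 1 + (L ^+ 2 + L + L * n) <= 4 * L ^+ 2 * n.
    by have := L1; lra.
  apply: ler_pM => //; first by rewrite addr_ge0// mulr_ge0// ltW.
  have : 2 * s * (1 + (L ^+ 2 + L + L * n)) <= 2 * s * (4 * L ^+ 2 * n).
    by rewrite ler_pM2l// mulr_gt0.
  by rewrite [2 * s * (1 + _)]mulrDr mulr1; lra.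
rewrite [leLHS](_ : _ = (8 * L ^+ 3 * s) * n * m (C j.+1)); last by ring.
rewrite ler_pM2r// ler_pM2r; last by lra.
by rewrite lerDr mulr_ge0// ltW.
Qed.

(** The weak-type estimate at level 1, applied to the r-th power of |f - avg D_1| / lam on D_1,
    whose measure is at most L mu(B). *)
Lemma exceptional_measure_le :
  (mu (\bigcup_(Q in exceptional) Q) <= (K * ((s / lam) `^ r * (L * m B)))%:E)%E.
Proof.
have K0 : 0 <= K by rewrite (le_trans ler01)// (hull_constant_ge1 bb BB).
have mD := ball_measurable bb (BD 1%N).
have FB : exceptional `<=` Balls by move=> Q [].
rewrite -[leLHS]mul1e.
apply: (le_trans (measure_bigcup_balls_le bb (V := D 1%N)
  (g := fun x => ((`|f x - avg (D 1%N)| / lam) `^ r)%:E) FB _ mD _ _ _ ltr01 K0 _)).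
- by move=> Q [_ QD _].
- exact: (ball_lty bb (BD 1%N)).
- exact: (@measurable_dist_pow _ _ _ _ _ _ _ Lrf).
- by move=> x _; rewrite lee_fin powR_ge0.
- move=> Q [BQ _ hQ]; rewrite mul1r.
  have := lt_le_trans hQ (integral_dist_le bb r1 Lrf (avg (D 1%N)) BQ lam0).
  set J := (\int[mu]_(x in Q) _)%E.
  have J0 : (0 <= J)%E by apply: integral_ge0 => x _; rewrite lee_fin powR_ge0.
  case: J J0 => [j| |]//= _; last by rewrite leey.
  rewrite -EFinM -EFinD !lte_fin lee_fin => h.
  by rewrite -(ler_pM2l lam0); lra.
rewrite EFinM lee_wpmul2l ?lee_fin//.
apply: (le_trans (integral_osc_pow_le bb r1 Lrf s0 osc_le (BD 1%N) BD1 lam0)).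
rewrite lee_fin ler_wpM2l ?powR_ge0//.
by have := chain_le chainD 0; have [-> _ _ _ _] := chainD.
Qed.

(** * Comparison of the maximal function at two points *)

Variable G : X -> set (set X).
Hypothesis completeG : forall x, complete_at mu Balls eta x (G x).

Local Notation T := (c2 * L ^+ 2 * (2 * lam + 8 * L ^+ 3 * s) * W).

Let c2_gt0 : 0 < c2.
Proof. by have [_ _ _ []] := reg. Qed.

(** One error term [T] then serves large and small balls alike. *)
Let T_ge_large : c2 * L ^+ 2 * (2 * s * L) * W <= T.
Proof.
rewrite ler_wpM2r// ler_wpM2l//; first by rewrite mulr_ge0 ?sqr_ge0// ltW.
apply: (@le_trans _ _ (8 * L ^+ 3 * s)); last by rewrite lerDr mulr_ge0// ltW.
rewrite [leRHS](_ : _ = 2 * s * L * (4 * L ^+ 2)); last by ring.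
rewrite ler_peMr//; last by have := exprn_ege1 2 L1; lra.
by rewrite !mulr_ge0 ?(ltW s0)// (le_trans ler01).
Qed.

Lemma phi_mean_large A (C : nat -> set X) :
  ball_chain mu Balls K eta A C -> B `<=` C 1%N ->
  (phi_mean A <= (`|avg (C 1%N)| + T)%:E)%E /\
  (`|avg (C 1%N)|%:E <= phi_mean A + T%:E)%E.
Proof.
move=> chainC BC1; apply: phi_mean_near; first exact: (chain_ball0 chainC).
by apply: (le_trans (integral_dist_phi_large chainC BC1)); rewrite lee_fin.
Qed.

(** Moves a scale to another point: A' stands in for A among the balls of [G x], and its phi-mean
    will be compared with the average over C_1. *)
Lemma complete_chain_exists x A : Balls A -> A x -> B `<=` A ->
  exists A' C, [/\ G x A', ball_chain mu Balls K eta A' C, A `<=` C 1%N &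
    m (C 1%N) <= L * eta * m A].
Proof.
move=> BA Ax BA'; have [GB _ /(_ _ BA Ax)[A' GA' [AA' mA']]] := completeG x.
have BA1 := GB _ GA'; have [C chainC] := ball_chain_exists bb eta1 dbl BA1.
exists A', C; split => //.
  exact: subset_trans AA' (@chain_sub0 _ _ _ _ _ _ _ bb _ _ chainC 1%N).
have := chain_le chainC 0; have [-> _ _ _ _] := chainC => /le_trans; apply.
rewrite -mulrA ler_wpM2l//; first by rewrite (le_trans ler01).
by rewrite -lee_fin EFinM -!(ballE bb).
Qed.

(** Two errors [T] for replacing phi-means by norms of averages, plus the distance between these
    averages. *)
Local Notation M := (2 * T + 2 * s * L * (1 + eta)).

Local Notation good := (B `\` \bigcup_(Q in exceptional) Q).

(** D' is D_1 if A is no larger than B, and C_1 otherwise. It is chosen before x', so the first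
    bound alone controls the maximal function at x, while completeness at x' supplies A' with a
    nearby average. *)
Lemma phi_mean_comparison x A : good x -> G x A -> exists D',
  [/\ Balls D', B `<=` D', (phi_mean A <= (`|avg D'| + T)%:E)%E &
     forall x', good x' -> exists A', G x' A' /\
       (`|avg D'|%:E <= phi_mean A' + (T + 2 * s * L * (1 + eta))%:E)%E].
Proof.
move=> [Bx xE] GA; have [GB Gx _] := completeG x.
have BA := GB _ GA; have Ax := Gx _ GA.
have [C chainC] := ball_chain_exists bb eta1 dbl BA.
have BC := chain_ball chainC.
have sL : 0 <= 2 * s * L by rewrite !mulr_ge0 ?(ltW s0)// (le_trans ler01).
have [AB|BA'] := leP (m A) (m B).
  exists (D 1%N); split => //.
    apply: (phi_mean_near BA _).1.
    exact: (integral_dist_phi_small chainC AB Ax Bx xE).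
  move=> x' [Bx' _].
  have [A' [C' [GA' chainC' BC' mC']]] := complete_chain_exists BB Bx' (@subset_refl _ B).
  exists A'; split => //; have [_ h] := phi_mean_large chainC' BC'.
  have h1 : `|avg B - avg (C' 1%N)| <= 2 * s * (L * eta).
    by apply: avg_step => //; exact: (chain_ball chainC').
  (* Passing from D_1 to B costs 2 s L, and from B to C'_1 costs 2 s L eta. *)
  have h2 : `|avg (D 1%N)| <= `|avg (C' 1%N)| + 2 * s * L * (1 + eta).
    have := ler_distD (avg B) (avg (D 1%N)) (avg (C' 1%N)).
    have := ler_distD (avg (C' 1%N)) (avg (D 1%N)) 0; rewrite !subr0.
    by rewrite (distrC (avg (D 1%N)) (avg B)); move: avg_B_D1; nra.
  rewrite EFinD addeA; apply: le_trans (leeD2r _ h).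
  by rewrite -EFinD lee_fin.
have BC1 : B `<=` C 1%N.
  apply: subset_trans (@chain_star _ _ _ _ _ _ _ _ _ chainC 0%N).
  have [-> _ _ _ _] := chainC; apply: (sub_star bb) => //; last by exists x.
  by have := ball_gt0 bb BA; lra.
exists (C 1%N); split => //; first by have [] := phi_mean_large chainC BC1.
move=> x' [Bx' _].
have [A' [C' [GA' chainC' BC' mC']]] := complete_chain_exists (BC 1%N) (BC1 _ Bx') BC1.
exists A'; split => //.
have [_ h] := phi_mean_large chainC' (subset_trans BC1 BC').
have h1 : `|avg (C 1%N) - avg (C' 1%N)| <= 2 * s * (L * eta).
  apply: avg_step => //; first exact: (chain_ball chainC').
  exact: subset_trans BC1 BC'.
have h2 : `|avg (C 1%N)| <= `|avg (C' 1%N)| + 2 * s * L * (1 + eta).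
  have := ler_distD (avg (C' 1%N)) (avg (C 1%N)) 0; rewrite !subr0.
  by nra.
rewrite EFinD addeA; apply: le_trans (leeD2r _ h).
by rewrite -EFinD lee_fin.
Qed.

Lemma maximal_le_maximal x x' : good x -> good x' ->
  (maximal mu phi G f x <= maximal mu phi G f x' + M%:E)%E.
Proof.
move=> Ex Ex'; apply: ge_ereal_sup => _ [A GA <-].
have [D' [BD' BD1' hA /(_ _ Ex')[A' [GA' h]]]] := phi_mean_comparison Ex GA.
apply: (le_trans hA); rewrite EFinD.
apply: (@le_trans _ _ (phi_mean A' + (T + 2 * s * L * (1 + eta))%:E + T%:E)%E).
  by rewrite leeD2r.
rewrite -addeA -EFinD [X in (_ + X%:E)%E](_ : _ = M); last by ring.
by rewrite leeD2r//; apply: ereal_sup_ubound; exists A'.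
Qed.

(** Finiteness matters because [osc] counts the difference of two equal infinities as infinite.
    Every D' of [phi_mean_comparison] contains B, so [average_norm_le] bounds all means at once. *)
Lemma maximal_fin_num x : good x -> maximal mu phi G f x \is a fin_num.
Proof.
move=> Ex; have [Bx _] := Ex.
rewrite ge0_fin_numE.
  set N := fine (\int[mu]_x (`|f x| `^ r)%:E)%E.
  apply: (@le_lt_trans _ _ (1 + N / m B + T)%:E); last exact: ltry.
  apply: ge_ereal_sup => _ [A GA <-].
  have [D' [BD' BD1' hA _]] := phi_mean_comparison Ex GA.
  apply: (le_trans hA); rewrite lee_fin lerD2r.
  apply: (le_trans (average_norm_le bb r1 Lrf BD')); rewrite lerD2l.
  rewrite ler_wpM2l//; last first.
    by rewrite lef_pV2 ?posrE ?(ball_gt0 bb)// (ball_le bb).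
  by rewrite fine_ge0// integral_ge0// => y _; rewrite lee_fin powR_ge0.
(* A member of [G x] keeps the supremum from being -oo. *)
have [GB _ /(_ _ BB Bx)[A GA _]] := completeG x.
apply: (@le_trans _ _ (phi_mean A)).
  by apply: integral_ge0 => y _; rewrite lee_fin mulr_ge0// phi_ge0//; exact: GB.
by apply: ereal_sup_ubound; exists A.
Qed.

(** The competing set is B without the exceptional balls: their union has measure below (1 - alpha)
    mu(B), so more than alpha mu(B) remains. *)
Lemma osc_alpha_maximal_le (alpha : R) :
  K * ((s / lam) `^ r * (L * m B)) < (1 - alpha) * m B ->
  (osc_alpha mu B alpha (maximal mu phi G f) <= M%:E)%E.
Proof.
move=> small; have mB := ball_measurable bb BB.
have mU : measurable (\bigcup_(Q in exceptional) Q).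
  by have [_ _ _ _ sep] := bb; apply: sep => Q [].
have mE : measurable good by exact: measurableD.
apply: (@le_trans _ _ (osc mu good (maximal mu phi G f))).
  apply: ereal_inf_lbound; exists good => //; split => //.
  have : (mu B <= mu good + mu (\bigcup_(Q in exceptional) Q))%E.
    apply: (@le_trans _ _ (mu (good `|` \bigcup_(Q in exceptional) Q))).
      apply: le_measure; rewrite ?inE//; first exact: measurableU.
      move=> x Bx; have [xQ|xQ] := pselect ((\bigcup_(Q in exceptional) Q) x).
        by right.
      by left.
    exact: measureU2.
  move=> /le_trans/(_ (leeD2l _ exceptional_measure_le)).
  have Efin : mu good \is a fin_num.
    rewrite ge0_fin_numE//; apply: le_lt_trans (ball_lty bb BB).
    by apply: le_measure; rewrite ?inE// => x [].
  rewrite (ballE bb BB) -(fineK Efin) -EFinM -EFinD lee_fin lte_fin.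
  by lra.
(* The bound holds at every pair of points, so the set of violating pairs is empty. *)
apply: ereal_inf_lbound => /=; exists set0; split => //.
  rewrite /product_measure1; apply: integral0_eq => x _ /=.
  by rewrite xsection0 measure0.
move=> [x x'] [/= Ex Ex']; rewrite ltNge => /negP; apply.
have h := maximal_le_maximal Ex Ex'; have h' := maximal_le_maximal Ex' Ex.
move: h h' (maximal_fin_num Ex) (maximal_fin_num Ex').
case: (maximal mu phi G f x) => // a; case: (maximal mu phi G f x') => // b.
rewrite -!EFinD !lee_fin => h h' _ _.
by rewrite ler_norml; lra.
Qed.

End MaximalOscillation.

(** * Choice of the level and of the constants *)

Theorem theorem1p4 (R : realType) (K eta r c2 : R) :
  1 < eta -> 1 <= r ->
  exists2 c : R, 0 < c &
  forall (d : measure_display) (X : measurableType d)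
    (mu : {measure set X -> \bar R}) (Balls : set (set X))
    (U : completeNormedModType R) (w : R -> R)
    (phi : set X -> X -> R) (G : X -> set (set X)),
  ball_basis mu Balls K ->
  doubling mu Balls eta ->
  modulus_of_continuity w ->
  omega_regular mu Balls w c2 phi ->
  (forall x, complete_at mu Balls eta x (G x)) ->
  (omega_norm w < +oo)%E ->
  forall (f : X -> U), bochner_Lr mu r f ->
  forall B : set X, Balls B ->
  forall alpha : R, 0 < alpha < 1 ->
  (osc_alpha mu B alpha (maximal mu phi G f) <=
     c%:E * omega_norm w * ((1 - alpha) `^ (- r^-1))%:E *
     sharp_sup mu Balls r f B)%E.
Proof.
move=> eta1 r1.
pose L := chain_constant K eta.
have L1 : 1 <= L := chain_constant_ge1 K eta1.
pose c0 : R := 6 + 8 / ln 2.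
have c00 : 0 <= c0 by rewrite addr_ge0// divr_ge0// ln_ge0// ler1n.
(* [c * n * q * s] will dominate [M] for lam = 2 K L s q and W = c0 n. The absolute values keep [c]
   positive before the hypotheses give the signs of K and c2. *)
pose c := 2 * (`|c2| * L ^+ 2 * (4 * `|K| * L + 8 * L ^+ 3) * c0) +
  2 * L * (1 + eta).
have L0 : 0 <= L := le_trans ler01 L1.
have c_gt0 : 0 < c.
  apply: ltr_wpDl; last first.
    by rewrite !mulr_gt0 ?(lt_le_trans ltr01 L1)// addr_gt0// (lt_trans ltr01).
  do ?[by []|exact: exprn_ge0|apply: mulr_ge0|apply: addr_ge0].
exists c => // d X mu Balls U w phi G bb dbl mw reg cG wfin f Lrf B BB alpha
  /andP[a0 a1].
set S := sharp_sup mu Balls r f B.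
set q := (1 - alpha) `^ (- r^-1).
have a_gt0 : 0 < 1 - alpha by rewrite subr_gt0.
have r0 : 0 < r := lt_le_trans ltr01 r1.
have q1 : 1 <= q.
  rewrite /q powRN invf_ge1 ?powR_gt0//.
  rewrite [leRHS](_ : 1 = 1 `^ r^-1); last by rewrite powR1.
  rewrite ge0_ler_powR ?nnegrE ?invr_ge0 ?(ltW r0) ?(ltW a_gt0)//.
  by rewrite lerBlDr lerDl ltW.
have S0 : (0 <= S)%E.
  apply: (@le_trans _ _ (mean_osc mu r f B)); first exact: poweR_ge0.
  by apply: ereal_sup_ubound; exists B => //; split => //; exact: subset_refl.
have [n n1 wn] : exists2 n : R, 1 <= n & omega_norm w = n%:E.
  have := omega_norm_ge1 mw; move: wfin.
  by case: (omega_norm w) => // n _; rewrite lee_fin => n1; exists n.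
rewrite wn -!EFinM.
have cnq : 0 < c * n * q by rewrite !mulr_gt0// (lt_le_trans ltr01).
have [->|Sfin] := eqVneq S +oo%E; first by rewrite gt0_muley// leey.
have SE : S = (fine S)%:E by rewrite fineK// ge0_fin_numE// lt_neqAle Sfin leey.
have K1 := hull_constant_ge1 bb BB.
(* The preceding lemmas need a positive bound, while S may vanish; hence s > S, and s tends to S at
   the end. *)
have main s : fine S < s ->
    (osc_alpha mu B alpha (maximal mu phi G f) <= (c * n * q * s)%:E)%E.
  move=> Ss; have s0 : 0 < s by apply: le_lt_trans Ss; exact: fine_ge0.
  (* As q^-r = 1 - alpha and (2 K L)^-r <= (2 K L)^-1, this level bounds the exceptional measure by
     (1 - alpha) mu(B) / 2. *)
  pose lam := 2 * K * L * s * q.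
  have K0 : 0 < K := lt_le_trans ltr01 K1.
  have q0 : 0 < q := lt_le_trans ltr01 q1.
  have L_gt0 : 0 < L := lt_le_trans ltr01 L1.
  have lam0 : 0 < lam by rewrite !mulr_gt0.
  have oscs A : Balls A -> B `<=` A -> (mean_osc mu r f A <= s%:E)%E.
    move=> BA BA'; apply: (@le_trans _ _ S).
      by apply: ereal_sup_ubound; exists A.
    by rewrite SE lee_fin ltW.
  have sumW := weighted_dyadic_sum_le mw; rewrite wn -EFinM -/c0 in sumW.
  have [D chainD] := ball_chain_exists bb eta1 dbl BB.
  have small : K * ((s / lam) `^ r * (L * fine (mu B))) < (1 - alpha) * fine (mu B).
    have mB := ball_gt0 bb BB.
    have KL0 : 0 < 2 * K * L by rewrite !mulr_gt0.
    have -> : s / lam = (2 * K * L)^-1 * (1 - alpha) `^ r^-1.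
      have -> : (1 - alpha) `^ r^-1 = q^-1 by rewrite /q powRN invrK.
      by rewrite /lam; field; rewrite !gt_eqF.
    rewrite powRM ?invr_ge0 ?powR_ge0 ?(ltW KL0)// -powRrM mulVf ?gt_eqF//.
    rewrite powRr1 ?(ltW a_gt0)//.
    have KLr : (2 * K * L)^-1 `^ r <= (2 * K * L)^-1.
      rewrite ge1r_powR// invr_gt0 KL0/= invf_le1// -mulrA -[leLHS]mulr1.
      by rewrite ler_pM ?ler1n// -[leLHS]mulr1 ler_pM.
    apply: (@le_lt_trans _ _ (K * ((2 * K * L)^-1 * (1 - alpha) * (L * fine (mu B))))).
      by rewrite ler_wpM2l ?(ltW K0)// ler_wpM2r ?mulr_ge0 ?ler_wpM2r// ltW.
    rewrite [ltLHS](_ : _ = (1 - alpha) * fine (mu B) / 2); last first.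
      by field; rewrite !gt_eqF.
    by have := mulr_gt0 a_gt0 mB; lra.
  have := osc_alpha_maximal_le bb eta1 dbl mw reg sumW r1 Lrf BB s0 lam0 oscs chainD cG small.
  move=> /le_trans; apply; rewrite lee_fin.
  have c20 : 0 < c2 by have [_ _ _ []] := reg.
  (* Since q >= 1 and n >= 1, summands lacking these factors may be multiplied by them. *)
  have sq : s <= s * q by rewrite ler_peMr// ltW.
  have nq : 1 <= n * q by rewrite -[leLHS]mulr1 ler_pM.
  rewrite [leRHS](_ : _ = 2 * (c2 * L ^+ 2 *
      ((4 * K * L + 8 * L ^+ 3) * (s * q)) * (c0 * n)) +
      2 * s * L * (1 + eta) * (n * q)); last by rewrite /c !gtr0_norm//; ring.
  apply: lerD; last first.
    rewrite ler_peMr// mulr_ge0// ?mulr_ge0// ?(ltW s0)//.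
    by rewrite addr_ge0// ltW// (lt_trans ltr01).
  rewrite ler_pM2l// ler_wpM2r ?mulr_ge0 ?(le_trans ler01 n1)//.
  apply: ler_wpM2l; first by rewrite mulr_ge0 ?exprn_ge0// ltW.
  rewrite /lam [leRHS]mulrDl; apply: lerD.
    by rewrite le_eqVlt; apply/orP; left; apply/eqP; ring.
  by rewrite ler_wpM2l// mulr_ge0// exprn_ge0.
rewrite SE -EFinM; apply/lee_addgt0Pr => e e0.
have e' : 0 < e / (c * n * q) by rewrite divr_gt0.
have : fine S < fine S + e / (c * n * q) by rewrite ltrDl.
move=> /main/le_trans; apply; rewrite -EFinD lee_fin mulrDr.
by rewrite [_ * (e / _)]mulrC divfK// gt_eqF.
Qed.
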